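(* Let $m\in\mathbb{N}$, $\beta\in(0,1)$, $s\in(0,m)$, $U\subset\mathbb{R}^N$ open, and $u\in C^{2s+\beta}(U)\cap\mathcal{L}^1_s$. Then $$\int_{\mathbb{R}^N}u(x)\,L_{m,s}\varphi(x)\,dx=\int_{\mathbb{R}^N}L_{m,s}u(x)\,\varphi(x)\,dx\qquad\text{for all }\varphi\in\mathcal{C}^\infty_c(U).$$
   Context: $N\in\mathbb{N}=\{1,2,\ldots\}$ is the dimension. Functions are real-valued on $\mathbb{R}^N$. For $m\in\mathbb{N}$, $\delta_m u(x,y):=\sum_{k=-m}^m(-1)^k\binom{2m}{m-k}u(x+ky)$. For $s\in(0,m)$, $$L_{m,s}u(x):=\frac{c_{N,m,s}}{2}\int_{\mathbb{R}^N}\frac{\delta_m u(x,y)}{|y|^{N+2s}}\,dy,$$ where $$c_{N,m,s}:=\frac{4^s\Gamma(\frac N2+s)}{\pi^{N/2}\Gamma(-s)}\Big(\sum_{k=1}^m(-1)^k\binom{2m}{m-k}k^{2s}\Big)^{-1}\quad\text{if }s\in(0,m)\setminus\mathbb{N},$$ $$c_{N,m,s}:=\frac{4^s\Gamma(\frac N2+s)\,s!}{2\pi^{N/2}}\Big(\sum_{k=2}^m(-1)^{k-s+1}\binom{2m}{m-k}k^{2s}\ln(k)\Big)^{-1}\quad\text{if }s\in\{1,\ldots,m-1\}.$$ $\mathcal{L}^1_s:=\{u\in L^1_{loc}(\mathbb{R}^N):\int_{\mathbb{R}^N}\frac{|u(x)|}{1+|x|^{N+2s}}dx<\infty\}$.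 For $t=k+\tau$ with $k\in\mathbb{N}_0=\mathbb{N}\cup\{0\}$, $\tau\in(0,1]$ and $U$ open, $C^t(U)$ is the space of functions that are $k$-times continuously differentiable in $U$ with derivatives of order $k$ locally $\tau$-Hölder continuous in $U$ (locally Lipschitz if $\tau=1$). $\mathcal{C}^\infty_c(U)$ is the space of smooth functions with compact support in $U$, extended by zero to $\mathbb{R}^N$; the product $L_{m,s}u\,\varphi$ is understood to be zero outside $U$. *)

(* Defs.v *)
From HB Require Import structures.
From mathcomp Require Import all_boot all_order all_algebra.
From mathcomp Require Import all_classical all_reals all_analysis.

Set Implicit Arguments.
Unset Strict Implicit.
Unset Printing Implicit Defensive.

Import Order.TTheory GRing.Theory Num.Theory.
Import numFieldNormedType.Exports.

Local Open Scope classical_set_scope.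
Local Open Scope ring_scope.

(* The product sigma-algebra of [n] copies of the Borel sigma-algebra of [R]
   (generated by the coordinates, as in the library for [n.-tuple T]); it is the
   Borel sigma-algebra of [R^n]. *)

Definition measure_rV_display : measure_display.
Proof. exact: default_measure_display. Qed.

Section measurable_rV.
Context {R : realType} (n : nat).

Let coord (i : 'I_n) (x : 'rV[R]_n) : measurableTypeR R := x ord0 i.

Let rV_set0 : g_sigma_preimage coord set0.
Proof. exact: sigma_algebra0. Qed.

Let rV_setC A : g_sigma_preimage coord A -> g_sigma_preimage coord (~` A).
Proof. exact: sigma_algebraC. Qed.

Let rV_bigcup (F : (set 'rV[R]_n)^nat) :
  (forall i, g_sigma_preimage coord (F i)) ->
  g_sigma_preimage coord (\bigcup_i (F i)).
Proof. exact: sigma_algebra_bigcup. Qed.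

HB.instance Definition _ := @isMeasurable.Build measure_rV_display
  'rV[R]_n (g_sigma_preimage coord) rV_set0 rV_setC rV_bigcup.

End measurable_rV.

Section measurable_coord.
Context {R : realType}.

Lemma measurable_coord n (i : 'I_n) :
  measurable_fun [set: 'rV[R]_n] (fun x => x ord0 i : measurableTypeR R).
Proof.
move=> _ Y mY; rewrite setTI; apply: sub_sigma_algebra => /=.
rewrite -bigcup_seq/=; exists i => /=; first by rewrite mem_index_enum.
by exists Y => //; rewrite setTI.
Qed.

Lemma measurable_fun_coordP d (T : measurableType d) n (f : T -> 'rV[R]_n) :
  (forall i, measurable_fun setT (fun x => f x ord0 i : measurableTypeR R)) ->
  measurable_fun setT f.
Proof.
move=> mf _ A mA; rewrite setTI.
have := @g_sigma_preimage_comp _ (measurableTypeR R) n 'rV[R]_n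
  (fun i x => x ord0 i) T f.
move=> /(congr1 (fun S => S (f @^-1` A))) E.
have : preimage_set_system [set: T] f
  (g_sigma_preimage (fun (i : 'I_n) (x : 'rV[R]_n) => x ord0 i : measurableTypeR R))
  (f @^-1` A) by exists A => //; rewrite setTI.
rewrite -E; apply: smallest_sub; first exact: sigma_algebra_measurable.
rewrite -bigcup_seq/=; apply: bigcup_sub => i _.
by move=> B [C mC <-]; exact: mf.
Qed.

Definition cons_rV n (p : measurableTypeR R * 'rV[R]_n) : 'rV[R]_(1 + n) :=
  row_mx (const_mx p.1) p.2.

Lemma measurable_cons_rV n :
  measurable_fun [set: measurableTypeR R * 'rV[R]_n] (@cons_rV n).
Proof.
apply: (@measurable_fun_coordP _ _ (1 + n)) => i.
rewrite /cons_rV; case: (split_ordP i) => j ->.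
  under eq_fun do rewrite row_mxEl mxE.
  exact: measurable_fst.
under eq_fun do rewrite row_mxEr.
exact: (measurableT_comp (measurable_coord j) measurable_snd).
Qed.

Definition uncons_rV n (x : 'rV[R]_(1 + n)) : measurableTypeR R * 'rV[R]_n :=
  (x ord0 (lshift n ord0), rsubmx x).

Lemma cons_rVK n : cancel (@cons_rV n) (@uncons_rV n).
Proof. by move=> [a v]; rewrite /uncons_rV row_mxKr row_mxEl mxE. Qed.

Lemma measurable_uncons_rV n :
  measurable_fun [set: 'rV[R]_(1 + n)] (@uncons_rV n).
Proof.
apply/measurable_fun_pairP; split => /=; first exact: measurable_coord.
apply: measurable_fun_coordP => i.
under eq_fun do rewrite mxE.
exact: measurable_coord.
Qed.

End measurable_coord.

Section cons_measure.
Local Open Scope ereal_scope.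
Context {R : realType} n (mu : {sigma_finite_measure set 'rV[R]_n -> \bar R}).

(* The image in [R^(1+n)] of the product of the 1-dimensional Lebesgue measure
   with [mu]. *)
Definition cons_measure : set 'rV[R]_(1 + n) -> \bar R :=
  pushforward (@lebesgue_measure R \x mu) (@cons_rV R n).

Let measurable_preimage A : measurable A -> measurable (@cons_rV R n @^-1` A).
Proof. by move=> mA; rewrite -[_ @^-1` _]setTI; exact: measurable_cons_rV. Qed.

Let cons_measure0 : cons_measure set0 = 0.
Proof. by rewrite /cons_measure /pushforward preimage_set0 measure0. Qed.

Let cons_measure_ge0 A : 0 <= cons_measure A.
Proof. exact: (measure_ge0 (@lebesgue_measure R \x mu)). Qed.

Let cons_measure_sigma_additive : semi_sigma_additive cons_measure.
Proof.
move=> F mF tF mUF; rewrite /cons_measure /pushforward preimage_bigcup.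
apply: measure_semi_sigma_additive.
- by move=> k; exact: measurable_preimage.
- apply/trivIsetP => /= i j _ _ ij; rewrite -preimage_setI.
  by move/trivIsetP : tF => /(_ _ _ _ _ ij) ->//; rewrite preimage_set0.
- by rewrite -preimage_bigcup; exact: measurable_preimage.
Qed.

HB.instance Definition _ := isMeasure.Build _ _ _ cons_measure
  cons_measure0 cons_measure_ge0 cons_measure_sigma_additive.

Let cons_measure_sigma_finite : sigma_finite setT cons_measure.
Proof.
have /sigma_finiteP[F [FT ndF mF]] := sigma_finiteT (@lebesgue_measure R).
have /sigma_finiteP[G [GT ndG mG]] := sigma_finiteT mu.
have mFG k : measurable (F k `*` G k).
  by apply: measurableX; [have [] := mF k | have [] := mG k].
exists (fun k => @uncons_rV R n @^-1` (F k `*` G k)).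
  rewrite -preimage_bigcup (_ : \bigcup_k _ = setT) ?preimage_setT//.
  rewrite -subTset => -[x y] _.
  have [i _ Fix] : (\bigcup_i F i) x by rewrite -FT.
  have [j _ Gjy] : (\bigcup_i G i) y by rewrite -GT.
  exists (maxn i j) => //; split => /=.
  - by move: x Fix; exact/subsetPset/ndF/leq_maxl.
  - by move: y Gjy; exact/subsetPset/ndG/leq_maxr.
move=> k; split.
  by rewrite -[_ @^-1` _]setTI; exact: measurable_uncons_rV.
rewrite /cons_measure /pushforward -comp_preimage.
rewrite (_ : _ \o _ = id); last by apply/funext => p; exact: cons_rVK.
have [[mFk Fk_fin] [mGk Gk_fin]] := (mF k, mG k).
rewrite preimage_id product_measure1E//.
by rewrite lte_mul_pinfty// ge0_fin_numE.
Qed.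

HB.instance Definition _ := Measure_isSigmaFinite.Build _ _ _ cons_measure
  cons_measure_sigma_finite.

End cons_measure.

(* The n-fold product of the Lebesgue measure of [R]. *)
Fixpoint lebesgue_rV (R : realType) (n : nat) :
    {sigma_finite_measure set 'rV[R]_n -> \bar R} :=
  if n is n'.+1 then cons_measure (lebesgue_rV R n') else \d_ (0 : 'rV[R]_0).

(* [integrable] asks for Borel measurability.  Lebesgue measurable functions are
   those that agree almost everywhere with a Borel one.  No change is needed for
   the value of the integral: the integral of the library is defined for every
   function, the integral of a nonnegative one being the supremum of the
   integrals of the Borel simple functions below it, so that it does give the
   Lebesgue integral of every Lebesgue measurable function. *)
Definition lebesgue_integrable (R : realType) (n : nat) (D : set 'rV[R]_n)
    (f : 'rV[R]_n -> R) : Prop :=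
  exists2 g : 'rV[R]_n -> R,
    (lebesgue_rV R n).-integrable D (EFin \o g) &
    {ae lebesgue_rV R n, forall x, D x -> f x = g x}.

Definition L1loc (R : realType) (n : nat) (f : 'rV[R]_n -> R) : Prop :=
  forall K : set 'rV[R]_n, compact K -> lebesgue_integrable K f.

(* The library norm of ['rV[R]_n] is the sup norm. *)
Definition enorm (R : realType) (n : nat) (x : 'rV[R]_n) : R :=
  Num.sqrt (\sum_(i < n) x ord0 i ^+ 2).

(* [partials [:: i1; ...; ik] f] is d_i1 (... (d_ik f)). *)
Definition partials (R : realType) (n : nat) (l : seq 'I_n)
    (f : 'rV[R]_n -> R) : 'rV[R]_n -> R :=
  foldr (fun i g => fun x => 'D_(delta_mx ord0 i : 'rV[R]_n) g x) f l.

Definition k_times_cont_diff (R : realType) (n k : nat) (U : set 'rV[R]_n)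
    (f : 'rV[R]_n -> R) : Prop :=
  (forall (l : seq 'I_n) (i : 'I_n) (x : 'rV[R]_n), (size l < k)%N -> U x ->
     derivable (partials l f) x (delta_mx ord0 i)) /\
  (forall (l : seq 'I_n) (x : 'rV[R]_n), (size l <= k)%N -> U x ->
     {for x, continuous (partials l f)}).

Definition locally_holder (R : realType) (n : nat) (tau : R) (U : set 'rV[R]_n)
    (f : 'rV[R]_n -> R) : Prop :=
  forall x, U x -> exists (V : set 'rV[R]_n) (C : R),
    [/\ nbhs x V, V `<=` U &
        forall y z, V y -> V z -> `|f y - f z| <= C * enorm (y - z) `^ tau].

(* C^t(U), for t > 0; k and tau are determined by t. *)
Definition C_space (R : realType) (n : nat) (t : R) (U : set 'rV[R]_n)
    (f : 'rV[R]_n -> R) : Prop :=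
  exists (k : nat) (tau : R),
    [/\ 0 < tau <= 1, t = k%:R + tau, k_times_cont_diff k U f &
        forall l : seq 'I_n, size l = k -> locally_holder tau U (partials l f)].

(* C_c^oo(U), the elements being extended by zero to R^n *)
Definition C_c_infty (R : realType) (n : nat) (U : set 'rV[R]_n)
    (f : 'rV[R]_n -> R) : Prop :=
  let supp := closure [set x | f x != 0] in
  [/\ forall k, k_times_cont_diff k setT f, compact supp & supp `<=` U].

(* The space written with a calligraphic L, exponent 1 and index s. *)
Definition calL1 (R : realType) (n : nat) (s : R) (u : 'rV[R]_n -> R) : Prop :=
  L1loc u /\
  lebesgue_integrable setT (fun x => `|u x| / (1 + enorm x `^ (n%:R + 2 * s))).

(* Euler's integral, for x > 0, and Gamma(x) = Gamma(x+n)/(x(x+1)...(x+n-1)) with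
   n > -x otherwise; the value at the poles 0, -1, -2, ... is irrelevant. *)
Definition Gamma_integral (R : realType) (x : R) : R :=
  \int[@lebesgue_measure R]_(t in `]0, +oo[) (t `^ (x - 1) * expR (- t)).

Definition Gamma (R : realType) (x : R) : R :=
  if 0 < x then Gamma_integral x else
  let n := (Num.truncn (- x)).+1 in
  Gamma_integral (x + n%:R) / \prod_(i < n) (x + i%:R).

Definition c_const_nonint (R : realType) (N m : nat) (s : R) : R :=
  4 `^ s * Gamma (N%:R / 2 + s) / (pi `^ (N%:R / 2) * Gamma (- s)) *
  (\sum_(1 <= k < m.+1) (-1) ^+ k * 'C(2 * m, m - k)%:R * k%:R `^ (2 * s))^-1.

(* s = n is an integer; the exponent k - n + 1 of -1 is an integer. *)
Definition c_const_int (R : realType) (N m n : nat) : R :=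
  let s : R := n%:R in
  4 `^ s * Gamma (N%:R / 2 + s) * n`!%:R / (2 * pi `^ (N%:R / 2)) *
  (\sum_(2 <= k < m.+1) (-1) ^ (k%:Z - n%:Z + 1) *
     'C(2 * m, m - k)%:R * k%:R `^ (2 * s) * ln k%:R)^-1.

Definition c_const (R : realType) (N m : nat) (s : R) : R :=
  if s \is a Num.nat then c_const_int R N m (Num.truncn s)
  else c_const_nonint N m s.

(* The sum over -m <= k <= m, with k = j - m. *)
Definition delta (R : realType) (N m : nat) (u : 'rV[R]_N -> R)
    (x y : 'rV[R]_N) : R :=
  \sum_(0 <= j < (2 * m).+1) let k := j%:Z - m%:Z in
    (-1) ^ k * 'C(2 * m, `|m%:Z - k|%N)%:R * u (x + k%:~R *: y).

Definition L_integrand (R : realType) (N m : nat) (s : R) (u : 'rV[R]_N -> R)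
    (x y : 'rV[R]_N) : R :=
  delta m u x y / enorm y `^ (N%:R + 2 * s).

Definition L_op (R : realType) (N m : nat) (s : R) (u : 'rV[R]_N -> R)
    (x : 'rV[R]_N) : R :=
  c_const N m s / 2 * \int[lebesgue_rV R N]_y L_integrand m s u x y.

(* Main.v *)
From HB Require Import structures.
Require Import Defs.
From mathcomp Require Import all_boot all_order all_algebra.
From mathcomp Require Import all_classical all_reals all_analysis.
From mathcomp Require Import measurable_realfun ring lra.

Set Implicit Arguments.
Unset Strict Implicit.
Unset Printing Implicit Defensive.

Import Order.TTheory GRing.Theory Num.Theory.
Import numFieldNormedType.Exports.

Local Open Scope classical_set_scope.
Local Open Scope ring_scope.

(** Write [K y = |y|^-(N + 2s)] and let [delta f x y] be the central difference
of order [2m].  Up to the factor [c_const / 2], which is the same on both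
sides, the two sides are the iterated integrals in [y] and [x] of
[u x * delta phi x y * K y] and of [delta u x y * phi x * K y].  The
singularity of [K] needs no truncation, because both functions of [(x, y)] are
absolutely integrable on the product space.  By [Fubini] one may therefore
integrate first in [x], for a fixed [y]; there the identity
[int u x * delta phi x y dx = int delta u x y * phi x dx] is the translation
invariance of the Lebesgue measure together with the symmetry [k -> - k] of the
coefficients of the difference ([integral_delta_sym]).

Absolute integrability has two parts.

Near [y = 0] the difference is small: [|delta f x y| <= C * |y| ^ a] with
[a > 2s], uniformly for [x] in a compact set.  The central difference is a translate of
the iterated forward difference; each forward difference in the direction [y] is a sum of
coordinate increments, which the mean value theorem bounds by [|y|] times
partial derivatives, and differences commute with partial derivatives
([iter_fdiff_le]).  After [k] derivatives have been used, one of the remaining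
differences gives the factor [|y| ^ tau] of the Holder condition; when
[k >= 2m], all the differences are used up and [a = 2m]
([delta_locally_le_holder], [delta_locally_le_smooth]).  The function
[|y| ^ a * K y] is integrable on the unit ball since [a > 2s]
([integral_near_kern_lty]).

Away from [y = 0] the kernel is at most a multiple of the weight
[w x = 1 / (1 + |x| ^ (N + 2s))], which is integrable, and
[w x * w y <= C * w (x + k y)] for [|k| >= 1] ([weight_peetre]).  This
inequality moves the decay in [y] to decay in [x]: it gives
[int |delta phi x y| K y dy <= C * w x], which can be integrated against [|u|],
and [int |delta u x y| K y dy <= C * (|u x| + 1 / w x)] on the support of [phi]
([delta_kern_le], [shift_bounded_test], [shift_bounded_weighted]).

Finally [u] is only almost everywhere equal to a Borel function.  As it is
continuous on [U], the Borel function can be chosen equal to [u] on [U]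
([borel_representative]); the replacement changes the differences
[delta u x y], [x] in [U], only for a negligible set of [y], hence no
integral. *)

(** * The Lebesgue measure on row vectors *)

Section measure_rV.
Context {R : realType}.
Implicit Types (n : nat).
Local Notation leb := (@lebesgue_measure R).

(** It suffices to compare, on half-open intervals, the Lebesgue measure with
[|k|] times its image: these intervals determine the measure. *)
Lemma lebesgue_measure_affine (x k : R) (A : set R) : k != 0 -> measurable A ->
  pushforward leb (fun t : measurableTypeR R => (x + k * t) : measurableTypeR R) A
  = ((`|k|^-1)%:E * leb A)%E.
Proof.
move=> k0 mA.
have mf : measurable_fun setT (fun t : measurableTypeR R => (x + k * t) : measurableTypeR R).
  by apply: measurable_funD => //; apply: measurable_funM.
pose pm := measure_function_pushforward__canonical__measure_function_Measure leb mf.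
pose m : {measure set (measurableTypeR R) -> \bar R} := mscale (NngNum (normr_ge0 k)) pm.
suff -> : leb A = m A.
  by rewrite /m /mscale/= muleA -EFinM mulVf ?mul1e// normr_eq0.
apply: lebesgue_measure_unique => // _ [[a b]] _ <-.
rewrite -[m _]/((`|k|)%:E * leb ((fun t : R => x + k * t)%R @^-1` `]a, b]%classic))%E.
have [kgt0|klt0] := ltP 0 k.
  have -> : (fun t : R => x + k * t) @^-1` `]a, b]%classic = `](a - x) / k, (b - x) / k]%classic.
    apply/seteqP; split => t /=; rewrite !in_itv/= ltr_pdivrMr// ler_pdivlMr//;
    by move=> /andP[? ?]; apply/andP; split; lra.
  rewrite !lebesgue_measure_itv/= !lte_fin ltr_pM2r ?invr_gt0// ltrD2r.
  case: ifPn => ab; rewrite ?mule0// -!EFinB -EFinM gtr0_norm//; congr EFin; field.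
  by lra.
have {k0}k_lt0 : k < 0 by rewrite lt_neqAle k0.
have -> : (fun t : R => x + k * t) @^-1` `]a, b]%classic = `[(b - x) / k, (a - x) / k[%classic.
  apply/seteqP; split => t /=; rewrite !in_itv/= ltr_ndivlMr// ler_ndivrMr//;
  by move=> /andP[? ?]; apply/andP; split; lra.
rewrite !lebesgue_measure_itv/= !lte_fin ltr_nM2r ?invr_lt0// ltrD2r.
case: ifPn => ab; rewrite ?mule0// -!EFinB -EFinM ltr0_norm//; congr EFin; field.
by lra.
Qed.

Lemma measurable_affine_rV n (x : 'rV[R]_n) (k : R) :
  measurable_fun setT (fun y : 'rV[R]_n => x + k *: y).
Proof.
apply: measurable_fun_coordP => i.
under eq_fun do rewrite !mxE.
apply: measurable_funD => //; apply: measurable_funM => //.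
exact: measurable_coord.
Qed.

(** Tonelli for the first coordinate; it allows inductions on the dimension. *)
Lemma ge0_integral_cons n (f : 'rV[R]_(1 + n) -> \bar R) :
  measurable_fun setT f -> (forall x, 0 <= f x)%E ->
  (\int[lebesgue_rV R n.+1]_x f x =
   \int[leb]_a \int[lebesgue_rV R n]_v f (cons_rV (a, v)))%E.
Proof.
move=> mf f0.
rewrite [LHS](_ : _ = (\int[pushforward (leb \x lebesgue_rV R n) (@cons_rV R n)]_x f x)%E) //.
rewrite ge0_integral_pushforward//; last exact: measurable_cons_rV.
rewrite preimage_setT fubini_tonelli1//.
by apply: measurableT_comp => //; exact: measurable_cons_rV.
by move=> p; exact: f0.
Qed.

(** Each coordinate contributes one factor [|k|^-1]. *)
Lemma ge0_integral_affine n (f : 'rV[R]_n -> \bar R) (x : 'rV[R]_n) (k : R) :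
  k != 0 -> measurable_fun setT f -> (forall x, 0 <= f x)%E ->
  (\int[lebesgue_rV R n]_y f (x + k *: y)%R =
   ((`|k|^-1) ^+ n)%:E * \int[lebesgue_rV R n]_y f y)%E.
Proof.
move=> k0; elim: n => [|n IH] in x f * => mf f0.
  rewrite expr0 mul1e; apply: eq_integral => y _; congr f.
  by apply/rowP => -[].
have mfa : measurable_fun setT (fun y : 'rV[R]_n.+1 => f (x + k *: y)).
  by apply: (measurableT_comp mf); exact: measurable_affine_rV.
rewrite ge0_integral_cons// [in RHS]ge0_integral_cons//.
pose x1 : R := x ord0 (lshift n ord0 : 'I_(1 + n)).
pose x' : 'rV[R]_n := rsubmx (x : 'rV[R]_(1 + n)).
have E (a : R) v : x + k *: cons_rV (a, v) = cons_rV (x1 + k * a, x' + k *: v).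
  apply/rowP => i; rewrite /cons_rV !mxE /=.
  by case: split_ordP => j -> /=; rewrite !mxE// (ord1 j).
have mg a : measurable_fun setT (fun v : 'rV[R]_n => f (cons_rV (a, v))).
  apply: (measurableT_comp mf).
  by apply: (measurableT_comp (@measurable_cons_rV _ _)); exact: pair1_measurable.
under eq_integral => a _.
  under eq_integral => v _ do rewrite E.
  rewrite (IH _ (fun v => f (cons_rV (x1 + k * a, v))))//.
  over.
pose g (a : measurableTypeR R) := (\int[lebesgue_rV R n]_y f (cons_rV (a, y)))%E.
have mgg : measurable_fun setT g.
  apply: (measurable_fun_fubini_tonelli_F (fun p => f (cons_rV p))) => //=.
  by apply: (measurableT_comp mf); exact: measurable_cons_rV.
have g0 a : (0 <= g a)%E by apply: integral_ge0.
pose aff (t : measurableTypeR R) : measurableTypeR R := x1 + k * t.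
have maff : measurable_fun setT aff.
  by apply: measurable_funD => //; apply: measurable_funM.
have mga : measurable_fun setT (fun a : measurableTypeR R => g (x1 + k * a)%R).
  exact: (measurableT_comp mgg).
transitivity ((`|k|^-1 ^+ n)%:E * \int[leb]_a g (x1 + k * a)%R)%E.
  by rewrite -(ge0_integralZl_EFin _ _ _ mga)// exprn_ge0// invr_ge0.
rewrite exprSr EFinM -muleA; congr (_ * _)%E.
have -> : (\int[leb]_x g (x1 + k * x)%R = \int[pushforward leb aff]_x g x)%E.
  by rewrite ge0_integral_pushforward.
pose c := `|k|^-1.
have c0 : 0 <= c by rewrite invr_ge0.
rewrite (eq_measure_integral (mscale (NngNum c0) leb)).
  by rewrite ge0_integral_mscale.
by move=> A mA _; exact: lebesgue_measure_affine.
Qed.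

(** The positive and the negative part are translated separately, which covers
functions that have no finite integral. *)
Lemma integral_translation n (f : 'rV[R]_n -> \bar R) (z : 'rV[R]_n) : measurable_fun setT f ->
  (\int[lebesgue_rV R n]_x f (x + z)%R = \int[lebesgue_rV R n]_x f x)%E.
Proof.
move=> mf.
have ge0 (g : 'rV[R]_n -> \bar R) : measurable_fun setT g -> (forall x, 0 <= g x)%E ->
    (\int[lebesgue_rV R n]_x g (x + z)%R = \int[lebesgue_rV R n]_x g x)%E.
  move=> mg g0.
  have := ge0_integral_affine z (oner_neq0 R) mg g0.
  rewrite normr1 invr1 expr1n mul1e => <-.
  by apply: eq_integral => x _; rewrite scale1r addrC.
rewrite integralE [RHS]integralE -(ge0 f^\+%E) -?(ge0 f^\-%E)//.
- congr (_ - _)%E; apply: eq_integral => x _; first by rewrite !funeposE.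
  by rewrite !funenegE.
- exact: measurable_funeneg.
- exact: measurable_funepos.
Qed.

Lemma integrable_translation n (f : 'rV[R]_n -> \bar R) (z : 'rV[R]_n) :
  (lebesgue_rV R n).-integrable setT f -> (lebesgue_rV R n).-integrable setT (fun x => f (x + z)).
Proof.
move=> /integrableP[mf fi]; apply/integrableP; split.
  apply: (measurableT_comp mf).
  have -> : +%R^~ z = (fun y : 'rV[R]_n => z + 1 *: y).
    by apply/funext => y; rewrite scale1r addrC.
  exact: measurable_affine_rV.
rewrite (integral_translation _ (f := fun x => `|f x|%E))//.
exact: measurableT_comp.
Qed.

End measure_rV.

Section norm_rV.
Context {R : realType} {n : nat}.
Implicit Types (x y : 'rV[R]_n).

Lemma normr_rV_leP x (e : R) : 0 <= e -> (`|x| <= e) <-> (forall i, `|x ord0 i| <= e).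
Proof.
move=> e0; rewrite [leLHS]/Num.norm/= mx_normrE; split.
  by move=> /bigmax_leP/= [_ H] i; exact: (H (ord0, i)).
by move=> H; apply/bigmax_leP; split => // -[i j] _ /=; rewrite (ord1 i).
Qed.

Lemma coord_le_normr x i : `|x ord0 i| <= `|x|.
Proof. by move: i; apply/normr_rV_leP. Qed.

Lemma enorm_ge0 x : 0 <= enorm x.
Proof. exact: sqrtr_ge0. Qed.

Lemma normr_le_enorm x : `|x| <= enorm x.
Proof.
apply/normr_rV_leP; first exact: enorm_ge0.
move=> i; rewrite -sqrtr_sqr /enorm ler_wsqrtr//.
by rewrite (bigD1 i)//= lerDl sumr_ge0// => j _; rewrite sqr_ge0.
Qed.

Lemma enorm_le_normr x : (0 < n)%N -> enorm x <= n%:R * `|x|.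
Proof.
move=> n0; rewrite -[leRHS]ger0_norm ?mulr_ge0// -sqrtr_sqr /enorm ler_wsqrtr//.
rewrite (@le_trans _ _ (\sum_(i < n) `|x| ^+ 2))//.
  apply: ler_sum => i _; rewrite -real_normK ?num_real// ler_sqr ?nnegrE//.
  exact: coord_le_normr.
rewrite sumr_const card_ord -[_ *+ n]mulr_natl exprMn ler_wpM2r ?sqr_ge0//.
by rewrite expr2 ler_peMl// ler1n.
Qed.

Lemma measurable_enorm : measurable_fun setT (@enorm R n).
Proof.
apply: measurableT_comp; first exact: continuous_measurable_fun (@sqrt_continuous R).
apply: measurable_sum => i; apply: measurable_funX; exact: measurable_coord.
Qed.

(** The sigma-algebra is generated by the coordinates, so it has to be checked
that it contains the open sets: an open set is a countable union of cubes with
a rational center and radius [1 / k.+1]. *)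
Lemma open_measurable_rV (U : set 'rV[R]_n) : open U -> measurable U.
Proof.
move=> oU.
pose box (p : 'rV[rat]_n * nat) : set 'rV[R]_n :=
  [set x | forall i, `|x ord0 i - ratr (p.1 ord0 i)| < p.2.+1%:R^-1].
pose F p := if pselect (box p `<=` U) then box p else set0.
have mbox p : measurable (box p).
  have -> : box p = \bigcap_(i in [set: 'I_n]) [set x | `|x ord0 i - ratr (p.1 ord0 i)| < p.2.+1%:R^-1].
    by apply/seteqP; split => x /=; [move=> H i _; exact: H|move=> H i; exact: H].
  apply: fin_bigcap_measurable; first exact: finite_finset.
  move=> i _; have := measurable_coord i measurableT
    (measurable_ball (ratr (p.1 ord0 i) : R) p.2.+1%:R^-1).
  rewrite setTI; congr (measurable _); apply/seteqP.
  by split => x; rewrite /= -ball_normE /= distrC.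
suff -> : U = \bigcup_p F p.
  apply: countable_bigcupT_measurable => //.
  by move=> p; rewrite /F; case: pselect => ?; [exact: mbox|exact: measurable0].
apply/seteqP; split => [x Ux|x [p _]]; last first.
  by rewrite /F; case: pselect => // pU /pU.
have /nbhs_ballP[e /= e0 xU] := open_nbhs_nbhs (conj oU Ux).
have [k ke] : exists k : nat, k.+1%:R^-1 < e / 2.
  exists (Num.truncn (2 / e)); rewrite -[e / 2]invrK ltf_pV2 ?posrE ?invr_gt0 ?divr_gt0//.
  by rewrite invf_div; exact: truncnS_gt.
have /choice[q qP] : forall i : 'I_n, exists q : rat, `|x ord0 i - ratr q| < k.+1%:R^-1.
  move=> i.
  have : x ord0 i - k.+1%:R^-1 < x ord0 i + k.+1%:R^-1.
    by rewrite ltrBlDr -addrA ltrDl addr_gt0.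
  move=> /rat_in_itvoo[q]; rewrite in_itv/= => /andP[q1 q2]; exists q.
  move: q1 q2; set d := _^-1; move: (ratr q) => c q1 q2.
  by rewrite ltr_norml; apply/andP; split; lra.
exists (\row_i q i, k) => //; rewrite /F; case: pselect => [_ i|[]] /=.
  by rewrite mxE; exact: qP.
move=> y yq; apply: xU; rewrite -ball_normE/= (@le_lt_trans _ _ (2 * k.+1%:R^-1))//; last first.
  by move: ke; rewrite /=; set d := _^-1; rewrite ltr_pdivlMr// mulrC.
apply/normr_rV_leP => // i; have := yq i; rewrite !mxE/= => yqi.
have -> : x ord0 i - y ord0 i = (x ord0 i - ratr (q i)) - (y ord0 i - ratr (q i)) by ring.
rewrite (le_trans (ler_normB _ _))// mulr_natl mulr2n lerD//; apply: ltW => //.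
Qed.

Lemma measurable_normr_rV : measurable_fun setT (fun x : 'rV[R]_n => `|x|).
Proof.
apply: (measurability (@RGenOInfty.G R)).
  exact: RGenOInfty.measurableE.
move=> _ [_ [r ->] <-]; rewrite setTI.
apply: open_measurable_rV; apply: open_comp; last exact: interval_open.
by move=> x _; exact: norm_continuous.
Qed.

End norm_rV.

Section balls.
Context {R : realType}.

Lemma lebesgue_rV_box (n : nat) (r : R) : 0 <= r ->
  lebesgue_rV R n [set x | forall i, `|x ord0 i| <= r] = ((2 * r) ^+ n)%:E.
Proof.
move=> r0; elim: n => [|n IH].
  rewrite expr0 /= diracE.
  by rewrite mem_set// => -[].
rewrite [LHS]/= /cons_measure /pushforward.
have -> : @cons_rV R n @^-1` [set x | forall i, `|x ord0 i| <= r] =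
    `[- r, r]%classic `*` [set x : 'rV[R]_n | forall i, `|x ord0 i| <= r].
  apply/seteqP; split => -[a v] /=.
    move=> H; split; last first.
      by move=> i; have := H (rshift 1 i); rewrite /cons_rV/= row_mxEr.
    by have := H (lshift n ord0); rewrite /cons_rV/= row_mxEl mxE in_itv/= ler_norml.
  move=> [ar vr] i; rewrite /cons_rV/=; case: (split_ordP i) => j ->.
    by rewrite row_mxEl mxE ler_norml; move: ar; rewrite in_itv.
  by rewrite row_mxEr.
have mb : measurable [set x : 'rV[R]_n | forall i, `|x ord0 i| <= r].
  have -> : [set x : 'rV[R]_n | forall i, `|x ord0 i| <= r] =
    setT `&` (fun x : 'rV[R]_n => `|x|) @^-1` `]-oo, r]%classic.
    rewrite setTI; apply/seteqP; split => x /=; rewrite in_itv/=; first by move/normr_rV_leP => ->.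
    by move/normr_rV_leP; apply.
  by apply: measurable_normr_rV => //.
have E : lebesgue_measure (`[- r, r]%classic : set R) = (2 * r)%:E.
  rewrite lebesgue_measure_itv/= lte_fin; case: ifPn => [_|].
    by rewrite -EFinB; congr EFin; ring.
  rewrite -leNgt => rr; have -> : r = 0 by apply/eqP; rewrite eq_le r0 andbT; lra.
  by rewrite mulr0.
by rewrite product_measure1E// exprS EFinM; congr (_ * _)%E; [exact: E|exact: IH].
Qed.

Lemma measurable_ball_rV n (r : R) : measurable [set x : 'rV[R]_n | `|x| <= r].
Proof.
have -> : [set x : 'rV[R]_n | `|x| <= r] =
    setT `&` (fun x : 'rV[R]_n => `|x|) @^-1` `]-oo, r]%classic.
  by rewrite setTI; apply/seteqP; split => x /=; rewrite in_itv.
exact: measurable_normr_rV.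
Qed.

Lemma lebesgue_rV_ball n (r : R) : 0 <= r ->
  lebesgue_rV R n [set x | `|x| <= r] = ((2 * r) ^+ n)%:E.
Proof.
move=> r0; rewrite -lebesgue_rV_box//; congr (lebesgue_rV R n _).
by apply/seteqP; split => x /= /(normr_rV_leP _ r0).
Qed.

(** A function that on the [j]-th shell, contained in the ball of radius [rho j],
is at most [C * q ^ j] divided by [rho j ^ n] is dominated by a series of
multiples of indicators of balls whose integrals form a geometric series.  It
replaces polar coordinates for powers of the norm. *)
Lemma ge0_integral_shells_lty n (g : 'rV[R]_n -> R) (rho : nat -> R) (C q : R) :
  measurable_fun setT g -> (forall y, 0 <= g y) ->
  (forall j, 0 < rho j) -> 0 <= C -> 0 < q < 1 ->
  (forall y, g y = 0 \/ exists2 j, `|y| <= rho j & g y * rho j ^+ n <= C * q ^+ j) ->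
  (\int[lebesgue_rV R n]_y (g y)%:E < +oo)%E.
Proof.
move=> mg g0 rho0 C0 /andP[q0 q1] gP.
pose h j (y : 'rV[R]_n) := (C * q ^+ j * rho j ^- n * \1_[set y | `|y| <= rho j] y)%:E.
have h0 j y : (0 <= h j y)%E.
  by rewrite lee_fin !mulr_ge0// ?invr_ge0 ?exprn_ge0// ltW.
have mh j : measurable_fun setT (h j).
  apply/measurable_EFinP; apply: measurable_funM => //.
  by apply: measurable_indic; exact: measurable_ball_rV.
apply: (@le_lt_trans _ _ (\int[lebesgue_rV R n]_y (\sum_(0 <= j <oo) h j y))%E).
  apply: ge0_le_integral => //.
  - by move=> y _; rewrite lee_fin.
  - exact/measurable_EFinP.
  - by apply: ge0_emeasurable_sum.
  move=> y _; have [->|[j yj gj]] := gP y.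
    exact: nneseries_ge0.
  apply: (@le_trans _ _ (h j y)).
    rewrite lee_fin indicE mem_set// mulr1 ler_pdivlMr// exprn_gt0//.
  rewrite (@nneseriesD1 _ (fun j => h j y) j)//.
  by rewrite leeDl// nneseries_ge0.
rewrite integral_nneseries//.
pose S := C * 2 ^+ n.
have hS j : (\int[lebesgue_rV R n]_y h j y = (geometric S q j)%:E)%E.
  rewrite /h; under eq_integral do rewrite EFinM.
  rewrite ge0_integralZl_EFin//; last 2 first.
  - by apply/measurable_EFinP/measurable_indic; exact: measurable_ball_rV.
  - by rewrite !mulr_ge0// ?invr_ge0 ?exprn_ge0// ltW.
  rewrite integral_indic//; last exact: measurable_ball_rV.
  rewrite setIT; transitivity ((C * q ^+ j / rho j ^+ n)%:E * ((2 * rho j) ^+ n)%:E)%E.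
    by congr (_ * _)%E; apply: lebesgue_rV_ball; exact: ltW.
  rewrite -EFinM; congr EFin; rewrite /S /= exprMn; field.
  by rewrite expf_neq0// gt_eqF.
apply: (@le_lt_trans _ _ (S * (1 - q)^-1)%:E); last exact: ltry.
apply: lime_le; first by apply: is_cvg_nneseries => j _ _; exact: integral_ge0.
apply: nearW => k; under eq_bigr do rewrite hS.
rewrite sumEFin lee_fin; apply: geometric_le_lim => //.
  by rewrite mulr_ge0.
by rewrite gtr0_norm.
Qed.

End balls.

(** * The kernel and the weight *)

Section kernel_weight.
Context {R : realType} {n : nat}.
Implicit Types (x y : 'rV[R]_n) (p : R).

Definition kern p y : R := (enorm y `^ p)^-1.
Definition weight p x : R := (1 + enorm x `^ p)^-1.

Lemma kern_ge0 p y : 0 <= kern p y.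
Proof. by rewrite invr_ge0 powR_ge0. Qed.

Let weight_den_ge1 p x : 1 <= 1 + enorm x `^ p.
Proof. by rewrite lerDl powR_ge0. Qed.

Lemma weight_gt0 p x : 0 < weight p x.
Proof. by rewrite invr_gt0 (lt_le_trans ltr01). Qed.

Lemma weight_le1 p x : weight p x <= 1.
Proof. by rewrite invf_le1// (lt_le_trans ltr01). Qed.

Lemma measurable_kern p : measurable_fun setT (kern p).
Proof.
have -> : kern p = (@powR R ^~ (- p)) \o @enorm R n.
  by apply/funext => y; rewrite /= powRN.
exact: (measurableT_comp (measurable_powR _) measurable_enorm).
Qed.

Lemma measurable_weight p : measurable_fun setT (weight p).
Proof.
have -> : weight p = (@powR R ^~ (- 1)) \o (fun x => 1 + enorm x `^ p).
  by apply/funext => y; rewrite /= powR_inv1// (le_trans ler01).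
apply: measurableT_comp; first exact: measurable_powR.
apply: measurable_funD => //.
exact: (measurableT_comp (measurable_powR _) measurable_enorm).
Qed.

Lemma enormZ (k : R) y : enorm (k *: y) = `|k| * enorm y.
Proof.
rewrite -sqrtr_sqr /enorm -sqrtrM ?sqr_ge0// mulr_sumr; congr Num.sqrt.
by apply: eq_bigr => i _; rewrite mxE exprMn.
Qed.

Lemma enormN y : enorm (- y) = enorm y.
Proof. by rewrite -scaleN1r enormZ normrN1 mul1r. Qed.

Lemma weightN p y : weight p (- y) = weight p y.
Proof. by rewrite /weight enormN. Qed.

Lemma kern_le_weight p r y : 0 <= p -> 0 < r -> r <= `|y| ->
  kern p y <= (1 + r `^ (- p)) * weight p y.
Proof.
move=> p0 r0 ry; have e0 : 0 < enorm y.
  by apply: lt_le_trans r0 (le_trans ry _); exact: normr_le_enorm.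
have ep : r `^ p <= enorm y `^ p.
  apply: ge0_ler_powR => //; rewrite ?nnegrE ?(ltW r0) ?(ltW e0)//.
  exact: le_trans ry (normr_le_enorm _).
have r1 : 0 < r `^ p by exact: powR_gt0.
have e1 : 0 < enorm y `^ p by exact: powR_gt0.
rewrite /kern /weight powRN ler_pdivlMr ?addr_gt0// mulrDr mulr1 mulVf ?gt_eqF//.
by rewrite addrC lerD2l lef_pV2 ?posrE.
Qed.

Lemma weight_scale p (k : R) y : 0 <= p -> 1 <= `|k| ->
  weight p y <= `|k| `^ p * weight p (k *: y).
Proof.
move=> p0 k1; have k1p : 1 <= `|k| `^ p.
  by rewrite -[leLHS](powRr0 `|k|); apply: ler_powR.
rewrite /weight ler_pdivlMr ?(lt_le_trans ltr01)//.
rewrite mulrC ler_pdivrMr ?(lt_le_trans ltr01)//.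
rewrite enormZ powRM ?enorm_ge0// mulrDr mulr1 lerD2r//.
Qed.

(** Peetre's inequality, from [|x + y| <= 2 n max(|x|, |y|)]; the factor [n]
compares the Euclidean norm with the sup norm. *)
Lemma weightM_le p x y : (0 < n)%N -> 0 <= p ->
  weight p x * weight p y <= (2 * n%:R) `^ p * weight p (x + y).
Proof.
move=> n0 p0.
have n1 : (1 : R) <= n%:R by rewrite ler1n.
pose M := Num.max (enorm x) (enorm y).
have M0 : 0 <= M by rewrite le_max enorm_ge0.
have : enorm (x + y) `^ p <= (2 * n%:R) `^ p * (enorm x `^ p + enorm y `^ p).
  apply: (@le_trans _ _ ((2 * n%:R * M) `^ p)).
    apply: ge0_ler_powR; rewrite ?nnegrE ?mulr_ge0 ?enorm_ge0//.
    rewrite (le_trans (enorm_le_normr _ n0))// [2 * _]mulrC -mulrA ler_pM2l ?ltr0n//.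
    rewrite (le_trans (ler_normD _ _))// mulr_natl mulr2n lerD//.
      by rewrite le_max normr_le_enorm.
    by rewrite le_max normr_le_enorm orbT.
  rewrite (@powRM _ (2 * n%:R) M) ?mulr_ge0//; apply: ler_wpM2l; first exact: powR_ge0.
  by rewrite /M; case: (leP (enorm x) (enorm y)) => _; rewrite ?lerDl ?lerDr powR_ge0.
have k1 : 1 <= (2 * n%:R : R) `^ p.
  by rewrite -[leLHS](powRr0 (2 * n%:R : R)); apply: ler_powR => //; lra.
rewrite /weight; move: (powR_ge0 (enorm x) p) (powR_ge0 (enorm y) p) (powR_ge0 (enorm (x + y)) p) k1.
move: (_ `^ p) (enorm y `^ p) (enorm (x + y) `^ p) (_ `^ p) => a b c k a0 b0 c0 k1 ck.
rewrite -invfM ler_pdivlMr ?(lt_le_trans ltr01) ?lerDl//.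
rewrite mulrC ler_pdivrMr; last by rewrite mulr_gt0// (lt_le_trans ltr01) ?lerDl.
have : 0 <= k * (a * b) by rewrite !mulr_ge0// (le_trans _ k1).
lra.
Qed.

Let nat_floor (t : R) : 0 <= t -> exists j : nat, j%:R <= t < j.+1%:R.
Proof. by move=> t0; exists (Num.truncn t); exact: truncn_itv. Qed.

Let expR_itv01 (q : R) : 0 < q -> 0 < expR (- q) < 1.
Proof. by move=> q0; rewrite expR_gt0 -expR0 ltr_expR oppr_lt0. Qed.

(** Outside of the unit ball the shells are [exp j <= |y| < exp (j + 1)]; on the
[j]-th one the weight times the volume is of order [exp (- b j)]. *)
Lemma integral_weight_lty (b : R) : 0 < b ->
  (\int[lebesgue_rV R n]_y (weight (n%:R + b) y)%:E < +oo)%E.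
Proof.
move=> b0; pose p := n%:R + b; have p0 : 0 <= p by rewrite addr_ge0// ltW.
apply: (@ge0_integral_shells_lty _ _ _ (fun j => expR j.+1%:R) (expR n%:R) (expR (- b))).
- exact: measurable_weight.
- by move=> y; exact/ltW/weight_gt0.
- by move=> j; exact: expR_gt0.
- exact: expR_ge0.
- exact: expR_itv01.
move=> y; right; have [y1|y1] := leP `|y| 1.
  (* the unit ball is put into the first shell *)
  exists 0%N; first by rewrite (le_trans y1)// -expR0 ler_expR.
  by rewrite expr0 mulr1 -expRM_natl mulr1 ler_piMl ?expR_ge0// weight_le1.
have y0 : 0 < `|y| by rewrite (lt_trans ltr01).
have [j /andP[jt tj]] := nat_floor (ln_ge0 (ltW y1)).
exists j; first by rewrite -[leLHS]lnK ?posrE// ler_expR ltW.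
have : weight p y <= expR (- (p * ln `|y|)).
  rewrite expRN lef_pV2 ?posrE ?expR_gt0 ?(lt_le_trans ltr01)//.
  rewrite mulrC expRM lnK ?posrE// ler_wpDl// ge0_ler_powR ?nnegrE ?enorm_ge0//.
  exact: normr_le_enorm.
move=> /(ler_wpM2r (exprn_ge0 n (expR_ge0 j.+1%:R))) /le_trans; apply.
rewrite -!expRM_natl -!expRD ler_expR /p.
set t := ln _ in jt tj *.
have : (n%:R + b) * j%:R <= (n%:R + b) * t by rewrite ler_wpM2l.
rewrite -natr1; lra.
Qed.

(** The shells are [exp (- j - 1) < |y| <= exp (- j)]; on the [j]-th one the
function times the volume is of order [exp (- (a - (p - n)) j)]. *)
Lemma integral_near_kern_lty (p a : R) : 0 <= p -> p - n%:R < a -> 0 < a ->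
  (\int[lebesgue_rV R n]_y (`|y| `^ a * kern p y * \1_[set z | `|z| <= 1] y)%:E < +oo)%E.
Proof.
move=> p0 pa a0; pose q := a - (p - n%:R); have q0 : 0 < q by rewrite subr_gt0.
apply: (@ge0_integral_shells_lty _ _ _ (fun j => expR (- j%:R)) (expR n%:R) (expR (- q))).
- apply: measurable_funM; last by apply: measurable_indic; exact: measurable_ball_rV.
  apply: measurable_funM; last exact: measurable_kern.
  apply: (measurableT_comp (measurable_powR a)); exact: measurable_normr_rV.
- by move=> y; rewrite !mulr_ge0 ?powR_ge0 ?kern_ge0.
- by move=> j; exact: expR_gt0.
- exact: expR_ge0.
- exact: expR_itv01.
move=> y; have [->|yn0] := eqVneq y 0.
  by left; rewrite normr0 powR0 ?gt_eqF// !mul0r.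
have y0 : 0 < `|y| by rewrite normr_gt0.
have [y1|y1] := leP `|y| 1; last first.
  by left; rewrite indicE memNset ?mulr0//=; apply/negP; rewrite -ltNge.
right; rewrite indicE mem_set// mulr1.
have t0 : 0 <= - ln `|y| by rewrite oppr_ge0 ln_le0.
have [j /andP[jt tj]] := nat_floor t0.
exists j; first by rewrite -[leLHS]lnK ?posrE// ler_expR; lra.
have : kern p y <= expR (- (p * ln `|y|)).
  rewrite expRN lef_pV2 ?posrE ?expR_gt0 ?powR_gt0//; last first.
    exact: lt_le_trans y0 (normr_le_enorm _).
  rewrite mulrC expRM lnK ?posrE// ge0_ler_powR ?nnegrE ?enorm_ge0//.
  exact: normr_le_enorm.
move=> /(ler_wpM2l (powR_ge0 `|y| a)) /(ler_wpM2r (exprn_ge0 n (expR_ge0 (- j%:R)))) /le_trans; apply.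
rewrite -[in `|y| `^ a](lnK (y0 : `|y| \is Num.pos)) -expRM -!expRM_natl -!expRD ler_expR.
set t := ln _ in t0 jt tj *.
have H1 : q * j%:R <= q * - t by rewrite ler_wpM2l// ltW.
have H2 : n%:R * (- t - j%:R) <= n%:R * 1 by rewrite ler_wpM2l//; rewrite -natr1 in tj; lra.
rewrite /q in H1 *; lra.
Qed.

End kernel_weight.

(** * Iterated finite differences *)

Section finite_differences.
Context {R : realType} {n : nat}.
Implicit Types (x y z : 'rV[R]_n) (f : 'rV[R]_n -> R).
Local Notation e_ i := (delta_mx ord0 i : 'rV[R]_n).

Lemma is_derive_line f z (v : 'rV[R]_n) (t : R) : derivable f (z + t *: v) v ->
  is_derive t (1 : R) (fun r => f (z + r *: v)) ('D_v f (z + t *: v)).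
Proof.
have E : (fun h : R => h^-1 *: (((fun r => f (z + r *: v)) \o shift t) (h *: 1) - f (z + t *: v)))
  = (fun h : R => h^-1 *: ((f \o shift (z + t *: v)) (h *: v) - f (z + t *: v))).
  apply/funext => h /=; congr (_ *: (f _ - _)).
  have -> : h *: (1 : R) = h by exact: mulr1.
  by rewrite scalerDl addrCA.
by move=> df; split; rewrite /derivable /derive E.
Qed.

Lemma coord_increment_le f z i (h M : R) :
  (forall t, `|t| <= `|h| -> derivable f (z + t *: e_ i) (e_ i) /\
     `|'D_(e_ i) f (z + t *: e_ i)| <= M) ->
  `|f (z + h *: e_ i) - f z| <= `|h| * M.
Proof.
move=> H; pose g (r : R) := f (z + r *: e_ i).
pose dg (r : R) := 'D_(e_ i) f (z + r *: e_ i).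
have dgP t : `|t| <= `|h| -> is_derive t (1 : R) g (dg t).
  by move=> /H[df _]; exact: is_derive_line.
have -> : f z = g 0 by rewrite /g scale0r addr0.
rewrite -/(g h).
suff main a b : a <= b -> (forall t, t \in `[a, b] -> `|t| <= `|h|) ->
    `|g b - g a| <= (b - a) * M.
  have [h0|h0] := leP 0 h.
    have := main _ _ h0; rewrite subr0 ger0_norm//; apply => t.
    by rewrite in_itv/= => /andP[t0 th]; rewrite ger0_norm// (le_trans t0).
  have := main _ _ (ltW h0); rewrite sub0r ltr0_norm// distrC; apply => t.
  by rewrite in_itv/= => /andP[t0 th]; rewrite ler0_norm// lerN2.
move=> ab abh.
have [c cab ->] : exists2 c, c \in `[a, b]%R & g b - g a = dg c * (b - a).
  apply: MVT_segment => //.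
    by move=> t tab; apply/dgP/abh; exact: subset_itv_oo_cc tab.
  apply: derivable_within_continuous => t tab.
  by apply: ex_derive; apply: dgP; exact: abh.
rewrite normrM mulrC ger0_norm ?subr_ge0// ler_wpM2l ?subr_ge0//.
by have [] := H c (abh _ cab).
Qed.

(** The segment from [z] to [z + y] is replaced by a path parallel to the axes,
which stays in the ball of the sup norm; the mean value theorem then applies
to one coordinate at a time, so that partial derivatives are enough. *)
Lemma increment_le f z y (M : R) :
  (forall x, `|x - z| <= `|y| -> forall i, derivable f x (e_ i) /\
     `|'D_(e_ i) f x| <= M) ->
  `|f (z + y) - f z| <= n%:R * `|y| * M.
Proof.
move=> H.
(* the [k]-th corner of the path: the first [k] coordinates of [y] are added *)
pose P (k : nat) := z + \row_j (if (j < k)%N then y ord0 j else 0).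
have P0 : P 0%N = z.
  by apply/rowP => j; rewrite !mxE addr0.
have Pn : P n = z + y.
  by apply/rowP => j; rewrite !mxE ltn_ord.
rewrite -Pn -[in X in _ - X]P0 -(telescope_sumr (f \o P))// big_mkord.
rewrite (le_trans (ler_norm_sum _ _ _))//.
have -> : n%:R * `|y| * M = \sum_(i < n) (`|y| * M).
  by rewrite sumr_const card_ord -mulrA mulr_natl.
apply: ler_sum => i _ /=.
have -> : P i.+1 = P i + y ord0 i *: e_ i.
  apply/rowP => j; rewrite !mxE /= ltnS leq_eqVlt -addrA; congr (_ + _).
  rewrite -val_eqE /=; case: (ltngtP j i) => //= ij; rewrite ?mulr0 ?addr0//.
  by rewrite add0r mulr1; congr (y ord0 _); apply: val_inj.
apply: (@le_trans _ _ (`|y ord0 i| * M)); last first.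
  have M0 : 0 <= M.
    have [//|_ +] := H z _ i; first by rewrite subrr normr0.
    exact: le_trans.
  by rewrite ler_wpM2r// coord_le_normr.
apply: coord_increment_le => t ty; apply: H.
apply/normr_rV_leP => // j; rewrite !mxE /=.
rewrite -[X in X - _]addrA [X in X - _]addrC addrK.
case: (ltngtP j i) => ji.
- by rewrite -val_eqE /= (ltn_eqF ji) mulr0 addr0 coord_le_normr.
- by rewrite -val_eqE /= (gtn_eqF ji) mulr0 addr0 normr0.
- rewrite -val_eqE /= ji eqxx mulr1 add0r (le_trans ty)// coord_le_normr//.
Qed.

Definition fdiff y f : 'rV[R]_n -> R := fun x => f (x + y) - f x.

Lemma fdiff_partial y f x i : derivable f (x + y) (e_ i) -> derivable f x (e_ i) ->
  derivable (fdiff y f) x (e_ i) /\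
  'D_(e_ i) (fdiff y f) x = fdiff y (fun z => 'D_(e_ i) f z) x.
Proof.
move=> d1 d2.
have E : (fun h : R => h^-1 *: (((fun z => f (z + y)) \o shift x) (h *: e_ i) - f (x + y)))
  = (fun h : R => h^-1 *: ((f \o shift (x + y)) (h *: e_ i) - f (x + y))).
  by apply/funext => h /=; rewrite addrA.
have d3 : derivable (fun z => f (z + y)) x (e_ i) by rewrite /derivable E.
split; first exact: derivableB.
rewrite [LHS](deriveB d3 d2); congr (_ - _).
by rewrite /derive E.
Qed.

(** Differences commute with partial derivatives; the ball has to contain every
point where the iterated difference evaluates [f]. *)
Lemma iter_fdiff_partial k y f x (r : R) i :
  (forall z, `|z - x| <= r -> derivable f z (e_ i)) ->
  k%:R * `|y| <= r ->
  derivable (iter k (fdiff y) f) x (e_ i) /\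
  'D_(e_ i) (iter k (fdiff y) f) x = iter k (fdiff y) (fun z => 'D_(e_ i) f z) x.
Proof.
elim: k x r => [|k IH] x r df kr /=.
  by split => //; apply: df; rewrite subrr normr0; move: kr; rewrite mul0r.
have y0 : 0 <= `|y| by [].
have ykr : k%:R * `|y| + `|y| <= r by rewrite -[X in _ + X]mul1r -mulrDl natr1.
have dxy z : `|z - (x + y)| <= r - `|y| -> derivable f z (e_ i).
  move=> zr; apply: df; have -> : z - x = z - (x + y) + y.
    by rewrite opprD addrA subrK.
  by rewrite (le_trans (ler_normD _ _))// -lerBrDr.
have [|d1 E1] := IH (x + y) (r - `|y|) dxy; first by rewrite lerBrDr.
have [|d2 E2] := IH x r df; first by rewrite (le_trans _ ykr)// lerDl.
by have [d3 ->] := fdiff_partial d1 d2; rewrite /fdiff E1 E2.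
Qed.

(** Each of [j] differences is exchanged for a factor [n * |y|] and a partial
derivative; the remaining [q] differences are kept on the derivatives of order
[j], where Holder continuity can be applied to them. *)
Lemma iter_fdiff_le j q f (x0 y : 'rV[R]_n) (r M : R) :
  (forall (l : seq 'I_n) i x, (size l < j)%N -> `|x - x0| < r ->
     derivable (partials l f) x (e_ i)) ->
  (forall (l : seq 'I_n) x, size l = j -> `|x - x0| + q%:R * `|y| < r ->
     `|iter q (fdiff y) (partials l f) x| <= M) ->
  forall z, `|z - x0| + (q + j)%:R * `|y| < r ->
    `|iter (q + j) (fdiff y) f z| <= (n%:R * `|y|) ^+ j * M.
Proof.
elim: j f => [|j IH] f df fM z zr.
  by rewrite addn0 expr0 mul1r; apply: (fM [::]); rewrite // addn0 in zr *.
rewrite addnS iterS exprS -mulrA [in leLHS]/fdiff.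
have y0 : 0 <= `|y| by [].
have yzr : `|z - x0| + (q + j)%:R * `|y| + `|y| < r.
  by rewrite -addrA -[X in _ + (_ + X)]mul1r -mulrDl natr1 -addnS.
apply: increment_le => x xz i.
have xr : `|x - x0| + (q + j)%:R * `|y| < r.
  apply: le_lt_trans yzr; rewrite -addrA [_ * _ + _]addrC addrA lerD2r.
  have -> : x - x0 = (z - x0) + (x - z) by rewrite [RHS]addrC subrKA.
  by rewrite (le_trans (ler_normD _ _))// lerD2l.
have [d ->] : derivable (iter (q + j) (fdiff y) f) x (e_ i) /\
  'D_(e_ i) (iter (q + j) (fdiff y) f) x =
  iter (q + j) (fdiff y) (fun z => 'D_(e_ i) f z) x.
  apply: (@iter_fdiff_partial _ _ _ _ ((q + j)%:R * `|y|)) => // w wx.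
  apply: (df [::]) => //; apply: le_lt_trans xr.
  have -> : w - x0 = (x - x0) + (w - x) by rewrite [RHS]addrC subrKA.
  by rewrite (le_trans (ler_normD _ _))// lerD2l.
split => //; apply: IH => //.
  move=> l k w lj wr; have := df (rcons l i) k w.
  by rewrite /partials foldr_rcons size_rcons; apply.
move=> l w lj wr; have := fM (rcons l i) w.
by rewrite /partials foldr_rcons size_rcons lj; apply.
Qed.

(** One difference carries the bound, each of the other [q] ones at most doubles
it. *)
Lemma iter_fdiff_le_exp2 q (f : 'rV[R]_n -> R) (x y : 'rV[R]_n) (M r : R) :
  (forall w, `|w - x| <= r -> `|fdiff y f w| <= M) -> q%:R * `|y| <= r ->
  `|iter q.+1 (fdiff y) f x| <= 2 ^+ q * M.
Proof.
elim: q x r => [|q IH] x r H qr.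
  by rewrite expr0 mul1r; apply: H; rewrite subrr normr0 (le_trans _ qr)// mul0r.
have ykr : q%:R * `|y| + `|y| <= r by rewrite -[X in _ + X]mul1r -mulrDl natr1.
rewrite iterS [in leLHS]/fdiff (le_trans (ler_normB _ _))// exprS -mulrA mulr_natl mulr2n.
rewrite lerD//.
  apply: (IH _ (r - `|y|)); last by rewrite lerBrDr.
  move=> w wr; apply: H; have -> : w - x = w - (x + y) + y.
    by rewrite opprD addrA subrK.
  by rewrite (le_trans (ler_normD _ _))// -lerBrDr.
by apply: (IH _ r) => //; rewrite (le_trans _ ykr)// lerDl.
Qed.

Lemma iter_fdiffE q f x y : iter q (fdiff y) f x =
  \sum_(0 <= j < q.+1) (-1) ^+ (q - j) * 'C(q, j)%:R * f (x + j%:R *: y).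
Proof.
elim: q x => [|q IH] x.
  by rewrite big_nat1 subn0 bin0 expr0 !mul1r scale0r addr0.
rewrite iterS {1}/fdiff !IH.
rewrite [RHS]big_nat_recl// [X in _ = _ + X](eq_big_nat _ _ (F2 := fun j =>
   (-1) ^+ (q - j) * 'C(q, j)%:R * f (x + y + j%:R *: y) +
   (-1) ^+ (q - j) * 'C(q, j.+1)%:R * f (x + j.+1%:R *: y))); last first.
  move=> j _; rewrite subSS binS natrD mulrDr mulrDl addrC; congr (_ * _ + _).
  by congr f; rewrite -addrA -[y in X in _ + (X + _)]scale1r -scalerDl nat1r.
rewrite big_split/= addrCA; congr (_ + _).
rewrite [in LHS]big_nat_recl// big_nat_recr//= (@bin_small q q.+1)// mulr0n mulr0 mul0r addr0.
rewrite opprD -sumrN !subn0 !bin0; congr (_ + _).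
  by rewrite exprS mulN1r !mulNr.
apply: eq_big_nat => j /andP[_ jq]; rewrite -!mulNr; congr (_ * _ * _).
by rewrite -(subSS j) subSn// exprS mulN1r.
Qed.

Lemma delta_iter_fdiff m f x y :
  delta m f x y = (-1) ^+ m * iter (2 * m) (fdiff y) f (x - m%:R *: y).
Proof.
rewrite /delta iter_fdiffE mulr_sumr; apply: eq_big_nat => j /andP[_ jm].
have -> : absz (m%:Z - (j%:Z - m%:Z))%R = (2 * m - j)%N.
  rewrite (_ : m%:Z - (j%:Z - m%:Z) = (2 * m - j)%N :> int) ?absz_nat//.
  by rewrite -subzn// mul2n -addnn PoszD; ring.
rewrite bin_sub// mulrA mulrA; congr (_ * _ * f _); last first.
  rewrite -addrA -scaleNr -scalerDl; congr (_ + _ *: _).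
  by rewrite rmorphB /= addrC !pmulrn.
rewrite expfzDr ?oppr_eq0 ?oner_eq0// -exprnN -[LHS]/((-1) ^+ j * ((-1) ^+ m)^-1).
rewrite invr_sign -!exprD -signr_odd -[RHS]signr_odd; congr (_ ^+ nat_of_bool _).
by rewrite !oddD oddB// mul2n odd_double addFb addbC.
Qed.

End finite_differences.

(** * Smallness of the central difference near the diagonal *)

Section near_delta.
Context {R : realType} {n : nat}.
Implicit Types (x y z : 'rV[R]_n) (f : 'rV[R]_n -> R).
Local Notation e_ i := (delta_mx ord0 i : 'rV[R]_n).

Definition delta_locally_le m f (a : R) x0 :=
  exists e C : R, [/\ 0 < e, 0 <= C &
    forall x y, `|x - x0| < e -> `|y| < e -> `|delta m f x y| <= C * `|y| `^ a].

Lemma delta_locally_le_partials m j q f x0 (r M b : R) :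
  (q + j = 2 * m)%N -> 0 < r -> 0 <= M -> 0 < j%:R + b ->
  (forall (l : seq 'I_n) i x, (size l < j)%N -> `|x - x0| < r ->
     derivable (partials l f) x (e_ i)) ->
  (forall (l : seq 'I_n) x y, size l = j -> `|x - x0| + q%:R * `|y| < r ->
     `|iter q (fdiff y) (partials l f) x| <= M * `|y| `^ b) ->
  delta_locally_le m f (j%:R + b) x0.
Proof.
move=> qj r0 M0 jb df fM; (* the forward difference starts at [x - m y] and has total step [2 m y], hence
   all its points are at distance less than [(1 + 3 m) e] from [x0] *)
pose d := (3 * m + 2)%:R : R.
have d0 : 0 < d by rewrite ltr0n addn2.
exists (r / d), (n%:R ^+ j * M); split; rewrite ?divr_gt0 ?mulr_ge0//.
move=> x y xr yr; rewrite delta_iter_fdiff normrM normrX normrN1 expr1n mul1r.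
rewrite powRD; last by apply/implyP; rewrite gt_eqF.
rewrite powR_mulrn//.
have -> : n%:R ^+ j * M * (`|y| ^+ j * `|y| `^ b) = (n%:R * `|y|) ^+ j * (M * `|y| `^ b).
  by rewrite exprMn; ring.
rewrite -qj; apply: (iter_fdiff_le df).
  by move=> l w lj wr; exact: fM.
rewrite qj addrAC (le_lt_trans (lerD (ler_normB _ _) (lexx _)))// normrZ normr_nat.
apply: (@lt_le_trans _ _ (r / d + m%:R * (r / d) + (2 * m)%:R * (r / d))).
  by rewrite ltr_leD ?ltr_leD//; rewrite ler_wpM2l// ltW.
have -> : r / d + m%:R * (r / d) + (2 * m)%:R * (r / d) = (r / d) * (1 + 3 * m%:R).
  by rewrite natrM; ring.
rewrite mulrAC ler_pdivrMr// ler_pM2l// /d natrD natrM addrC lerD2l.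
by rewrite ler1n.
Qed.

Lemma delta_locally_le_smooth m (U : set 'rV[R]_n) f x0 : (0 < m)%N -> open U -> U x0 ->
  k_times_cont_diff (2 * m) U f -> delta_locally_le m f (2 * m)%:R x0.
Proof.
move=> m0 oU Ux0 [df cf].
pose M := 1 + \sum_(t : (2 * m).-tuple 'I_n) `|partials t f x0|.
have nearM : \forall x \near x0, forall t : (2 * m).-tuple 'I_n, `|partials t f x| <= M.
  apply: (@filter_forall _ _ _ (nbhs x0)) => t.
  have /cvgr_dist_lt/(_ 1 ltr01) := cf t x0 (eq_leq (size_tuple t)) Ux0.
  apply: filterS => x fx.
  have -> : partials t f x = partials t f x0 - (partials t f x0 - partials t f x) by ring.
  rewrite (le_trans (ler_normB _ _))// addrC lerD//; first exact: ltW.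
  by rewrite (bigD1 t)//= lerDl sumr_ge0.
have /nbhs_ballP[r /= r0 xU] : nbhs (x0 : 'rV[R]_n)
    (U `&` [set x | forall t : (2 * m).-tuple 'I_n, `|partials t f x| <= M]).
  by apply: filterI => //; exact: open_nbhs_nbhs.
have {}xU x : `|x - x0| < r -> U x /\ forall t : (2 * m).-tuple 'I_n, `|partials t f x| <= M.
  by move=> xr; apply: xU; rewrite -ball_normE /= distrC.
have M0 : 0 <= M by rewrite addr_ge0// sumr_ge0.
rewrite -[X in delta_locally_le _ _ X]addr0.
apply: (@delta_locally_le_partials _ _ 0%N _ _ r M) => //.
- by rewrite addr0 ltr0n muln_gt0.
- by move=> l i x lm xr; apply: df => //; case: (xU x xr).
- move=> l x y lm; rewrite mul0r addr0 => /xU[_ H] /=.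
  rewrite powRr0 mulr1.
  by have := H (Tuple (introT eqP lm)).
Qed.

Lemma delta_locally_le_holder m k (tau : R) (U : set 'rV[R]_n) f x0 : (0 < n)%N ->
  (k < 2 * m)%N -> 0 < tau -> open U -> U x0 ->
  k_times_cont_diff k U f ->
  (forall l : seq 'I_n, size l = k -> locally_holder tau U (partials l f)) ->
  delta_locally_le m f (k%:R + tau) x0.
Proof.
move=> n0 km tau0 oU Ux0 [df _] hf.
have /choice[VC HVC] : forall t : k.-tuple 'I_n, exists VC : set 'rV[R]_n * R,
    nbhs x0 VC.1 /\ forall y z, VC.1 y -> VC.1 z ->
      `|partials t f y - partials t f z| <= VC.2 * enorm (y - z) `^ tau.
  by move=> t; have [V [C [? _ ?]]] := hf t (size_tuple t) x0 Ux0; exists (V, C).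
pose M0 := \sum_(t : k.-tuple 'I_n) `|(VC t).2|.
have M00 : 0 <= M0 by rewrite sumr_ge0.
have nearV : \forall x \near x0, forall t, (VC t).1 x.
  by apply: (@filter_forall _ _ _ (nbhs x0)) => t; have [] := HVC t.
have /nbhs_ballP[r /= r0 xU] : nbhs (x0 : 'rV[R]_n)
    (U `&` [set x | forall t, (VC t).1 x]).
  by apply: filterI => //; exact: open_nbhs_nbhs.
have {}xU x : `|x - x0| < r -> U x /\ forall t, (VC t).1 x.
  by move=> xr; apply: xU; rewrite -ball_normE /= distrC.
pose q := (2 * m - k).-1.
have qE : (q.+1 = 2 * m - k)%N by rewrite prednK// subn_gt0.
apply: (@delta_locally_le_partials _ _ q.+1 _ _ r (2 ^+ q * (M0 * n%:R `^ tau))) => //.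
- by rewrite qE subnK// ltnW.
- by rewrite !mulr_ge0// powR_ge0.
- by rewrite ltr_wpDl.
- by move=> l i x lm xr; apply: df => //; case: (xU x xr).
move=> l x y lk xyr; rewrite -2!mulrA -powRM//.
apply: (@iter_fdiff_le_exp2 _ _ _ _ _ _ _ (q%:R * `|y|)) => // w wx.
have wr : `|w - x0| + `|y| < r.
  apply: le_lt_trans xyr; rewrite -natr1 mulrDl mul1r addrA lerD2r.
  have -> : w - x0 = (x - x0) + (w - x) by rewrite [RHS]addrC subrKA.
  by rewrite (le_trans (ler_normD _ _))// lerD2l.
have wr0 : `|w - x0| < r by apply: le_lt_trans wr; rewrite lerDl.
pose t : k.-tuple 'I_n := Tuple (introT eqP lk).
have [_ /(_ t) Vw] := xU w wr0.
have [|_ /(_ t) Vwy] := xU (w + y).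
  apply: le_lt_trans wr; have -> : w + y - x0 = w - x0 + y by rewrite addrAC.
  exact: ler_normD.
have [_ HC] := HVC t.
have /le_trans := HC _ _ Vwy Vw; apply; rewrite [w + y]addrC addrK.
apply: (@le_trans _ _ (M0 * enorm y `^ tau)).
  rewrite ler_wpM2r ?powR_ge0// (le_trans (ler_norm _))//.
  by rewrite /M0 (bigD1 t)//= lerDl sumr_ge0.
rewrite ler_wpM2l// ge0_ler_powR ?nnegrE ?enorm_ge0 ?mulr_ge0//; first exact: ltW.
exact: enorm_le_normr.
Qed.

(** The radius and the constant are controlled by one parameter, [e = 1 / C], so
that compactness is applied to the filter of its small positive values. *)
Lemma delta_compact_le m f (a : R) (K : set 'rV[R]_n) : compact K ->
  (forall x0, K x0 -> delta_locally_le m f a x0) ->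
  exists e C : R, [/\ 0 < e, 0 <= C &
    forall x y, K x -> `|y| < e -> `|delta m f x y| <= C * `|y| `^ a].
Proof.
move=> cK loc.
pose P (i : R) x := forall y, `|y| < i -> `|delta m f x y| <= i^-1 * `|y| `^ a.
have P0 : \forall i \near (0 : R)^'+, K `<=` P i.
  apply: (proj1 (compact_near_coveringP K) cK).
  move=> x0 /loc[e [C [e0 C0 H]]].
  pose d := Num.min e (C + 1)^-1.
  have C1 : 0 < C + 1 by apply: ltr_wpDl.
  have d0 : 0 < d by rewrite lt_min e0 invr_gt0.
  exists (ball x0 e, `]0, d[%classic) => /=.
    split; first by apply/nbhs_ballP; exists e.
    near=> i; rewrite /= in_itv/=; apply/andP; split; near: i.
      exact: nbhs_right_gt.
    exact: nbhs_right_lt.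
  move=> [x i] /= [xe]; rewrite in_itv/= => /andP[i0 id] y yi.
  have [ie iC] : i < e /\ i < (C + 1)^-1 by move: id; rewrite /d lt_min => /andP.
  rewrite (le_trans (H _ _ _ _))//.
  - by move: xe; rewrite -ball_normE /= distrC.
  - exact: lt_trans ie.
  rewrite ler_wpM2r ?powR_ge0// (@le_trans _ _ (C + 1)) ?lerDl//.
  by rewrite -[leLHS]invrK lef_pV2 ?posrE ?invr_gt0// ltW.
have [i [/= i0 KP]] := @filter_ex _ _ _ _ (filterI (nbhs_right_gt (0 : R)) P0).
by exists i, i^-1; split => [//||x y Kx yi]; [rewrite invr_ge0 ltW|exact: KP].
Unshelve. all: by end_near. Qed.

End near_delta.

(** * Integrating the difference against the kernel *)

Section delta_kern.
Context {R : realType} {N : nat}.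
Implicit Types (x y z : 'rV[R]_N) (f u v : 'rV[R]_N -> R).
Variable N_gt0 : (0 < N)%N.
Variables (m : nat) (b : R).
Hypothesis b_gt0 : 0 < b.
Local Notation mu := (lebesgue_rV R N).
Let p : R := N%:R + b.
Let p_ge0 : 0 <= p. Proof. by rewrite addr_ge0// ltW. Qed.

Definition dcoef (j : nat) : R :=
  let k := j%:Z - m%:Z in (-1) ^ k * 'C(2 * m, `|m%:Z - k|%N)%:R.
Definition dnode (j : nat) : R := (j%:Z - m%:Z)%:~R.

Lemma deltaE f x y :
  delta m f x y = \sum_(0 <= j < (2 * m).+1) dcoef j * f (x + dnode j *: y).
Proof. by []. Qed.

Lemma dnode_int j : dnode j = 0 \/ 1 <= `|dnode j|.
Proof.
have [j0|j0] := eqVneq (j%:Z - m%:Z) 0; [left|right].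
  by rewrite /dnode j0.
by rewrite /dnode -intr_norm (_ : 1 = 1%:~R)// ler_int -gtz0_ge1 normr_gt0.
Qed.

Lemma dcoef_rev j : (j < (2 * m).+1)%N -> dcoef (2 * m - j) = dcoef j.
Proof.
move=> j2m; rewrite /dcoef.
have E : (2 * m - j)%N%:Z - m%:Z = - (j%:Z - m%:Z).
  by rewrite -subzn// mul2n -addnn PoszD; ring.
rewrite E; congr (_ * _).
  by rewrite -exprz_inv invrN1.
congr (_%:R).
rewrite (_ : absz (m%:Z - - (j%:Z - m%:Z))%R = j); last first.
  by rewrite opprK addrC subrK.
rewrite (_ : absz (m%:Z - (j%:Z - m%:Z))%R = (2 * m - j)%N) ?bin_sub//.
rewrite (_ : (m%:Z - (j%:Z - m%:Z))%R = (2 * m - j)%N :> int) ?absz_nat//.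
by rewrite -subzn// mul2n -addnn PoszD; ring.
Qed.

Lemma dnode_rev j : (j < (2 * m).+1)%N -> dnode (2 * m - j) = - dnode j.
Proof.
move=> j2m; rewrite /dnode.
have E : (2 * m - j)%N%:Z - m%:Z = - (j%:Z - m%:Z).
  by rewrite -subzn// mul2n -addnn PoszD; ring.
by rewrite E rmorphN.
Qed.

Lemma dnode_le j : (j < (2 * m).+1)%N -> `|dnode j| <= m%:R.
Proof.
rewrite ltnS mul2n -addnn => j2m; rewrite /dnode rmorphB /= -!pmulrn.
have j2 : (j%:R : R) <= m%:R + m%:R by rewrite -natrD ler_nat.
have j0 : (0 : R) <= j%:R by [].
by rewrite ler_norml; apply/andP; split; lra.
Qed.

Lemma measurable_shift f (k : R) : measurable_fun setT f ->
  measurable_fun setT (fun xy : 'rV[R]_N * 'rV[R]_N => f (xy.1 + k *: xy.2)).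
Proof.
move=> mf; apply: (measurableT_comp mf).
apply: measurable_fun_coordP => i.
under eq_fun do rewrite !mxE.
apply: measurable_funD; first exact: (measurableT_comp (measurable_coord i) measurable_fst).
apply: measurable_funM => //.
exact: (measurableT_comp (measurable_coord i) measurable_snd).
Qed.

Lemma measurable_delta f : measurable_fun setT f ->
  measurable_fun setT (fun xy : 'rV[R]_N * 'rV[R]_N => delta m f xy.1 xy.2).
Proof.
move=> mf; apply: measurable_sum => j; apply: measurable_funM => //.
exact: measurable_shift.
Qed.

Lemma measurable_delta_fixed f x : measurable_fun setT f ->
  measurable_fun setT (fun y => delta m f x y).
Proof. by move=> /measurable_delta mf; exact: (measurable_fun_pair2 x mf). Qed.

Lemma measurable_shift_fixed f (k : R) x : measurable_fun setT f ->
  measurable_fun setT (fun y => f (x + k *: y)).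
Proof. by move=> /(measurable_shift k) mf; exact: (measurable_fun_pair2 x mf). Qed.

Lemma integral_affine_le (g : 'rV[R]_N -> R) x (k : R) : 1 <= `|k| ->
  measurable_fun setT g -> (forall z, 0 <= g z) ->
  (\int[mu]_y (g (x + k *: y)%R)%:E <= \int[mu]_y (g y)%:E)%E.
Proof.
move=> k1 mg g0; rewrite (@ge0_integral_affine _ _ (fun y => (g y)%:E)).
- rewrite -[leRHS]mul1e lee_wpmul2r//.
    by apply: integral_ge0 => y _; rewrite lee_fin.
  by rewrite lee_fin exprn_ile1// ?invr_ge0// invf_le1// (lt_le_trans ltr01).
- by rewrite -normr_gt0 (lt_le_trans ltr01).
- exact/measurable_EFinP.
- by move=> y; rewrite lee_fin.
Qed.

(** It compares [y] with [k y] before Peetre's inequality is applied to [x] and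
[k y], which degenerates at [k = 0]: the central term of a difference is treated
separately. *)
Lemma weight_peetre x y (k : R) : 1 <= `|k| ->
  weight p x * weight p y <= (`|k| `^ p * (2 * N%:R) `^ p) * weight p (x + k *: y).
Proof.
move=> k1; apply: (@le_trans _ _ (weight p x * (`|k| `^ p * weight p (k *: y)))).
  by rewrite ler_wpM2l ?weight_scale// ltW// weight_gt0.
rewrite mulrCA -mulrA ler_wpM2l ?powR_ge0//.
exact: weightM_le.
Qed.

(** The bound, up to a constant, of the part of the integral that is away from
the singularity and comes from one node of the difference; [B] is [weight] for
a test function and [|u| + 1 / weight] for the function [u]. *)
Definition shift_bounded (f B : 'rV[R]_N -> R) (k : R) :=
  exists2 C : R, 0 <= C & forall x,
    (\int[mu]_y (`|f (x + k *: y)| * weight p y)%:E <= (C * B x)%:E)%E.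

(** On [|y| < e] the integrand is at most an integrable power of [|y|]; elsewhere
[kern] is at most a multiple of [weight] and the terms of the difference are
bounded one by one. *)
Lemma delta_kern_le f (B : 'rV[R]_N -> R) (K : set 'rV[R]_N) (a e C : R) :
  measurable_fun setT f -> (forall x, 0 <= B x) ->
  (forall k, k = 0 \/ 1 <= `|k| -> shift_bounded f B k) ->
  b < a -> 0 < e -> 0 <= C ->
  (forall x y, K x -> `|y| < e -> `|delta m f x y| <= C * B x * `|y| `^ a) ->
  exists2 D : R, 0 <= D & forall x, K x ->
    (\int[mu]_y (`|delta m f x y| * kern p y)%:E <= (D * B x)%:E)%E.
Proof.
move=> mf B0 fB ba e0 C0 near.
have /choice[c cP] : forall j, exists c : R, 0 <= c /\ forall x,
    (\int[mu]_y (`|f (x + dnode j *: y)| * weight p y)%:E <= (c * B x)%:E)%E.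
  by move=> j; have [c c0 H] := fB _ (dnode_int j); exists c.
(* the near part is integrated over the unit ball *)
wlog e1 : e e0 near / e <= 1.
  move=> H; apply: (H (Num.min e 1)); rewrite ?lt_min ?e0 ?ltr01//.
    by move=> x y Kx; rewrite lt_min => /andP[ye _]; exact: near.
  by rewrite ge_min lexx orbT.
pose nk y := `|y| `^ a * kern p y * \1_[set z : 'rV[R]_N | `|z| <= 1] y.
have nk0 y : 0 <= nk y by rewrite !mulr_ge0 ?powR_ge0 ?kern_ge0.
have mnk : measurable_fun setT nk.
  apply: measurable_funM; last by apply: measurable_indic; exact: measurable_ball_rV.
  apply: measurable_funM; last exact: measurable_kern.
  apply: (measurableT_comp (measurable_powR a)); exact: measurable_normr_rV.
have Ifin : (\int[mu]_y (nk y)%:E < +oo)%E.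
  apply: integral_near_kern_lty => //; last exact: lt_trans ba.
  by rewrite /p addrC addKr.
pose I0 := fine (\int[mu]_y (nk y)%:E)%E.
have I0E : (\int[mu]_y (nk y)%:E)%E = I0%:E.
  rewrite fineK// ge0_fin_numE//; apply: integral_ge0 => y _; rewrite lee_fin//.
have I00 : 0 <= I0 by rewrite -lee_fin -I0E; apply: integral_ge0 => y _; rewrite lee_fin.
pose E := 1 + e `^ (- p).
have E0 : 0 <= E by rewrite addr_ge0// powR_ge0.
exists (C * I0 + E * \sum_(0 <= j < (2 * m).+1) `|dcoef j| * c j).
  by rewrite addr_ge0 ?mulr_ge0// sumr_ge0// => j _; rewrite mulr_ge0//; have [] := cP j.
move=> x Kx.
pose far j y : R := `|f (x + dnode j *: y)| * weight p y.
have far0 j y : 0 <= far j y by rewrite mulr_ge0// ltW// weight_gt0.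
have mfar j : measurable_fun setT (far j).
  apply: measurable_funM; last exact: measurable_weight.
  by apply: measurableT_comp => //; exact: measurable_shift_fixed.
have CB0 : 0 <= C * B x by rewrite mulr_ge0.
apply: (@le_trans _ _ (\int[mu]_y ((C * B x)%:E * (nk y)%:E +
    E%:E * \sum_(0 <= j < (2 * m).+1) `|dcoef j|%:E * (far j y)%:E))%E).
  apply: ge0_le_integral => //.
  - by move=> y _; rewrite lee_fin mulr_ge0// kern_ge0.
  - apply/measurable_EFinP; apply: measurable_funM; last exact: measurable_kern.
    by apply: measurableT_comp => //; exact: measurable_delta_fixed.
  - apply: emeasurable_funD; first by apply/measurable_EFinP; apply: measurable_funM.
    apply: emeasurable_funM => //; apply: emeasurable_sum => j.
    by apply/measurable_EFinP; apply: measurable_funM.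
  move=> y _.
  rewrite -EFinM; under eq_bigr do rewrite -EFinM.
  rewrite sumEFin -EFinM -EFinD lee_fin.
  have S0 : 0 <= \sum_(0 <= j < (2 * m).+1) `|dcoef j| * far j y.
    by rewrite sumr_ge0// => j _; rewrite mulr_ge0.
  have [ye|ey] := ltP `|y| e.
    rewrite ler_wpDr ?mulr_ge0// /nk indicE mem_set ?mulr1/=; last first.
      by rewrite (le_trans (ltW ye)).
    by rewrite mulrA ler_wpM2r ?kern_ge0// near.
  apply: ler_wpDl; first exact: mulr_ge0.
  apply: (@le_trans _ _ (`|delta m f x y| * (E * weight p y))).
    by apply: ler_wpM2l => //; exact: kern_le_weight.
  rewrite mulrCA; apply: ler_wpM2l => //; rewrite deltaE.
  apply: (@le_trans _ _ ((\sum_(0 <= j < (2 * m).+1) `|dcoef j| * `|f (x + dnode j *: y)|) * weight p y)).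
    rewrite ler_wpM2r ?(ltW (weight_gt0 _ _))// (le_trans (ler_norm_sum _ _ _))//.
    by apply: ler_sum => j _; rewrite normrM.
  by rewrite mulr_suml; apply: ler_sum => j _; rewrite mulrA.
rewrite ge0_integralD//; last 4 first.
- by move=> y _; rewrite -EFinM lee_fin mulr_ge0.
- by apply/measurable_EFinP; apply: measurable_funM.
- by move=> y _; rewrite mule_ge0// sume_ge0// => j _; rewrite -EFinM lee_fin mulr_ge0.
- apply: emeasurable_funM => //; apply: emeasurable_sum => j.
  by apply/measurable_EFinP; apply: measurable_funM.
rewrite ge0_integralZl_EFin//; last 2 first.
- by move=> y _; rewrite lee_fin.
- exact/measurable_EFinP.
rewrite ge0_integralZl_EFin//; last 2 first.
- by move=> y _; rewrite sume_ge0// => j _; rewrite -EFinM lee_fin mulr_ge0.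
- apply: emeasurable_sum => j; by apply/measurable_EFinP; apply: measurable_funM.
rewrite ge0_integral_sum//; last 2 first.
- by move=> j; apply/measurable_EFinP; apply: measurable_funM.
- by move=> j y _; rewrite -EFinM lee_fin mulr_ge0.
rewrite I0E [((_ + _) * B x)%R]mulrDl [X in (_ <= X)%E]EFinD; apply: leeD.
  by rewrite -EFinM lee_fin mulrAC.
rewrite -mulrA EFinM; apply: lee_wpmul2l; first by rewrite lee_fin.
rewrite mulr_suml -sumEFin.
apply: lee_sum => j _; rewrite ge0_integralZl_EFin//; last 2 first.
- by move=> y _; rewrite lee_fin.
- exact/measurable_EFinP.
rewrite -mulrA EFinM; apply: lee_wpmul2l; first by rewrite lee_fin.
by have [_] := cP j; apply.
Qed.

End delta_kern.

(** * Exchanging the integrals *)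

Section nonlocal_fubini.
Context {R : realType} {N : nat}.
Implicit Types (x y z : 'rV[R]_N) (f u v : 'rV[R]_N -> R).
Variable N_gt0 : (0 < N)%N.
Variables (m : nat) (b : R).
Hypothesis b_gt0 : 0 < b.
Local Notation mu := (lebesgue_rV R N).
Let p : R := N%:R + b.
Let p_ge0 : 0 <= p. Proof. by rewrite addr_ge0// ltW. Qed.
Let w := @weight R N p.
Let w0 x : 0 < w x. Proof. exact: weight_gt0. Qed.
Let w1 x : w x <= 1. Proof. exact: weight_le1. Qed.
Let mw : measurable_fun setT w. Proof. exact: measurable_weight. Qed.

Let wI : (\int[mu]_y (w y)%:E < +oo)%E.
Proof. exact: integral_weight_lty. Qed.

Let Iw : R := fine (\int[mu]_y (w y)%:E)%E.

Let IwE : (\int[mu]_y (w y)%:E)%E = Iw%:E.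
Proof.
by rewrite fineK// ge0_fin_numE//; apply: integral_ge0 => y _; rewrite lee_fin ltW.
Qed.

Let Iw0 : 0 <= Iw.
Proof. by rewrite -lee_fin -IwE; apply: integral_ge0 => y _; rewrite lee_fin ltW. Qed.

(** Of the two factors [w (x + k y)] that bound [v], one is turned by Peetre's
inequality, together with [w y], into [w x]; the other one is kept and makes the
integral in [y] finite.  This is why the decay of [v] is measured by the square
of the weight. *)
Lemma shift_bounded_test v (C2 : R) (k : R) : measurable_fun setT v ->
  (forall z, `|v z| <= C2 * (w z * w z)) -> k = 0 \/ 1 <= `|k| ->
  shift_bounded b v w k.
Proof.
move=> mv vC.
have C20 : 0 <= C2.
  have := le_trans (normr_ge0 _) (vC 0).
  by rewrite pmulr_lge0// mulr_gt0.
have mvw x : measurable_fun setT (fun y => `|v (x + k *: y)| * w y).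
  apply: measurable_funM => //; apply: measurableT_comp => //.
  exact: measurable_shift_fixed.
move=> [k0|k1].
  exists (C2 * Iw); first by rewrite mulr_ge0.
  move=> x; rewrite k0.
  apply: (@le_trans _ _ (\int[mu]_y ((C2 * w x)%:E * (w y)%:E))%E); last first.
    rewrite ge0_integralZl_EFin//.
    - by rewrite IwE -EFinM lee_fin mulrAC.
    - by move=> y _; rewrite lee_fin ltW.
    - exact/measurable_EFinP.
    - by rewrite mulr_ge0// ltW.
  apply: ge0_le_integral => //.
  - by move=> y _; rewrite lee_fin mulr_ge0// ltW// w0.
  - by apply/measurable_EFinP; rewrite -k0; exact: mvw.
  - by apply/measurable_EFinP; apply: measurable_funM.
  move=> y _; rewrite -EFinM lee_fin scale0r addr0 ler_wpM2r ?(ltW (w0 y))//.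
  by rewrite (le_trans (vC _))// ler_wpM2l// ler_piMl// ltW.
pose c := `|k| `^ p * (2 * N%:R) `^ p.
have c0 : 0 <= c by rewrite mulr_ge0 ?powR_ge0.
exists (C2 * c * Iw); first by rewrite !mulr_ge0.
move=> x.
have mws : measurable_fun setT (fun y => w (x + k *: y)) by exact: measurable_shift_fixed.
apply: (@le_trans _ _ (\int[mu]_y ((C2 * c * w x)%:E * (w (x + k *: y)%R)%:E))%E); last first.
  rewrite ge0_integralZl_EFin//.
  - rewrite [(_ * Iw * _)%R]mulrAC [X in (_ <= X)%E]EFinM; apply: lee_wpmul2l.
      by rewrite lee_fin !mulr_ge0// ltW.
    by rewrite -IwE; apply: integral_affine_le => // z; exact: ltW.
  - by move=> y _; rewrite lee_fin ltW.
  - exact/measurable_EFinP.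
  - by rewrite !mulr_ge0// ltW.
apply: ge0_le_integral => //.
- by move=> y _; rewrite lee_fin mulr_ge0// ltW// w0.
- by apply/measurable_EFinP; exact: mvw.
- by apply/measurable_EFinP; apply: measurable_funM.
move=> y _; rewrite -EFinM lee_fin.
rewrite (le_trans (ler_wpM2r (ltW (w0 y)) (vC _)))//.
have -> : C2 * (w (x + k *: y) * w (x + k *: y)) * w y =
    C2 * w (x + k *: y) * (w (x + k *: y) * w y) by ring.
have -> : C2 * c * w x * w (x + k *: y) = C2 * w (x + k *: y) * (c * w x) by ring.
apply: ler_wpM2l; first by rewrite mulr_ge0// ltW.
(* Peetre's inequality at [x + k y], shifted back by [- k y] to [x] *)
have := @weight_peetre _ _ N_gt0 _ b_gt0 (x + k *: y) y (- k).
by rewrite normrN scaleNr addrK; apply.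
Qed.

(** Peetre's inequality turns [w y] into [w (x + k y) / w x], and
[|u (x + k y)| * w (x + k y)] is integrable in [y]. *)
Lemma shift_bounded_weighted u (k : R) : measurable_fun setT u ->
  (\int[mu]_x (`|u x| * w x)%:E < +oo)%E -> k = 0 \/ 1 <= `|k| ->
  shift_bounded b u (fun x => `|u x| + (w x)^-1) k.
Proof.
move=> um uI.
have uw0 x : 0 <= `|u x| * w x by rewrite mulr_ge0// ltW.
have muw : measurable_fun setT (fun x => `|u x| * w x).
  by apply: measurable_funM => //; exact: measurableT_comp.
pose Iu : R := fine (\int[mu]_y (`|u y| * w y)%:E)%E.
have IuE : (\int[mu]_y (`|u y| * w y)%:E)%E = Iu%:E.
  by rewrite fineK// ge0_fin_numE//; apply: integral_ge0 => y _; rewrite lee_fin.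
have Iu0 : 0 <= Iu.
  by rewrite -lee_fin -IuE; apply: integral_ge0 => y _; rewrite lee_fin.
have muy x : measurable_fun setT (fun y => `|u (x + k *: y)| * w y).
  apply: measurable_funM => //; apply: measurableT_comp => //.
  exact: measurable_shift_fixed.
have wi0 x : 0 <= (w x)^-1 by rewrite invr_ge0 ltW.
move=> [k0|k1].
  exists Iw => // x; rewrite k0.
  under eq_integral do rewrite scale0r addr0 EFinM.
  rewrite ge0_integralZl_EFin//.
  - by rewrite IwE -EFinM lee_fin mulrC ler_wpM2l// lerDl.
  - by move=> y _; rewrite lee_fin ltW.
  - exact/measurable_EFinP.
pose c := `|k| `^ p * (2 * N%:R) `^ p.
have c0 : 0 <= c by rewrite mulr_ge0 ?powR_ge0.
exists (c * Iu); first by rewrite mulr_ge0.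
move=> x.
have mus : measurable_fun setT (fun y => `|u (x + k *: y)| * w (x + k *: y)).
  exact: (@measurable_shift_fixed _ _ (fun z => `|u z| * w z)).
apply: (@le_trans _ _ (\int[mu]_y
    ((c / w x)%:E * (`|u (x + k *: y)| * w (x + k *: y))%:E))%E); last first.
  rewrite ge0_integralZl_EFin//.
  - apply: (@le_trans _ _ ((c / w x)%:E * Iu%:E)%E).
      apply: lee_wpmul2l; first by rewrite lee_fin mulr_ge0.
      rewrite -IuE.
      exact: (@integral_affine_le _ _ (fun z => `|u z| * w z)).
    rewrite -EFinM lee_fin mulrAC ler_wpM2l ?mulr_ge0//.
    by rewrite lerDr.
  - by move=> y _; rewrite lee_fin.
  - exact/measurable_EFinP.
  - by rewrite mulr_ge0.
apply: ge0_le_integral => //.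
- by move=> y _; rewrite lee_fin mulr_ge0// ltW// w0.
- by apply/measurable_EFinP; exact: muy.
- by apply/measurable_EFinP; apply: measurable_funM.
move=> y _; rewrite -EFinM lee_fin mulrCA ler_wpM2l//.
rewrite mulrAC ler_pdivlMr// mulrC.
exact: weight_peetre.
Qed.


Let K := @kern R N p.
Let K0 x : 0 <= K x. Proof. exact: kern_ge0. Qed.
Let mK : measurable_fun setT K. Proof. exact: measurable_kern. Qed.

Variables (u v : 'rV[R]_N -> R) (C2 : R).
Hypothesis um : measurable_fun setT u.
Hypothesis vm : measurable_fun setT v.
Hypothesis uI : (\int[mu]_x (`|u x| * w x)%:E < +oo)%E.
Hypothesis vC : forall z, `|v z| <= C2 * (w z * w z).

Let C20 : 0 <= C2.
Proof.
have := le_trans (normr_ge0 _) (vC 0).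
by rewrite pmulr_lge0// mulr_gt0.
Qed.

Let uw0 x : 0 <= `|u x| * w x. Proof. by rewrite mulr_ge0// ltW. Qed.

Let muw : measurable_fun setT (fun x => `|u x| * w x).
Proof. by apply: measurable_funM => //; exact: measurableT_comp. Qed.

Let integrable_uw : mu.-integrable setT (EFin \o (fun x => `|u x| * w x)).
Proof.
apply/integrableP; split; first exact/measurable_EFinP.
by under eq_integral do rewrite /= ger0_norm//.
Qed.

Lemma integrable_shift_test (z : 'rV[R]_N) :
  mu.-integrable setT (EFin \o (fun x => u x * v (x + z))).
Proof.
pose c := C2 * ((2 * N%:R) `^ p / w z).
have -> : (fun x => u x * v (x + z)) = (fun x => u x * v (z + 1 *: x)).
  by apply/funext => x; rewrite scale1r addrC.
apply: (@le_integrable _ _ _ mu _ measurableT _ (EFin \o (fun x => c * (`|u x| * w x)))).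
- apply/measurable_EFinP; apply: measurable_funM => //.
  exact: measurable_shift_fixed.
- move=> x _ /=; rewrite lee_fin normrM [leRHS]ger0_norm; last first.
    by rewrite mulr_ge0// mulr_ge0// divr_ge0 ?powR_ge0// ltW.
  rewrite mulrCA ler_wpM2l// (le_trans (vC _))// /c -mulrA ler_wpM2l//.
  rewrite (@le_trans _ _ (w (z + 1 *: x)))//; first by rewrite ler_piMl// ltW.
  rewrite mulrAC ler_pdivlMr//.
  have := weightM_le (z + 1 *: x) (- z) N_gt0 p_ge0.
  rewrite weightN (_ : z + 1 *: x - z = x)//.
  by rewrite scale1r addrAC subrr add0r.
- by have := integrableZl measurableT c integrable_uw; apply: eq_integrable.
Qed.

Lemma integrable_test_shift (z : 'rV[R]_N) :
  mu.-integrable setT (EFin \o (fun x => u (x + z) * v x)).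
Proof.
have := integrable_translation z (integrable_shift_test (- z)).
by apply: eq_integrable => // x _ /=; rewrite addrK.
Qed.

Lemma integral_shift_test (z : 'rV[R]_N) :
  (\int[mu]_x (u x * v (x + z))%:E = \int[mu]_x (u (x - z) * v x)%:E)%E.
Proof.
rewrite -(@integral_translation _ _ (fun x => (u x * v (x + z))%:E) (- z)).
  by apply: eq_integral => x _; rewrite subrK.
exact: measurable_int (integrable_shift_test z).
Qed.

Lemma integrable_mul_delta y :
  mu.-integrable setT (fun x => (u x * delta m v x y)%:E).
Proof.
have : mu.-integrable setT (fun x => \sum_(0 <= j < (2 * m).+1)
    ((dcoef m j)%:E * (u x * v (x + dnode m j *: y))%:E))%E.
  apply: integrable_sum => // j _.
  exact: (integrableZl measurableT _ (integrable_shift_test _)).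
apply: eq_integrable => // x _ /=; rewrite deltaE mulr_sumr -sumEFin.
by apply: eq_bigr => j _; rewrite -EFinM mulrCA.
Qed.

Lemma integrable_delta_mul y :
  mu.-integrable setT (fun x => (delta m u x y * v x)%:E).
Proof.
have : mu.-integrable setT (fun x => \sum_(0 <= j < (2 * m).+1)
    ((dcoef m j)%:E * (u (x + dnode m j *: y) * v x)%:E))%E.
  apply: integrable_sum => // j _.
  exact: (integrableZl measurableT _ (integrable_test_shift _)).
apply: eq_integrable => // x _ /=; rewrite deltaE mulr_suml -sumEFin.
by apply: eq_bigr => j _; rewrite -EFinM mulrA.
Qed.

(** The term of index [k] on the left is translated by [- k y] and becomes the
term of index [- k] on the right; the coefficients of [k] and [- k] are equal. *)
Lemma integral_delta_sym y :
  (\int[mu]_x (u x * delta m v x y)%:E = \int[mu]_x (delta m u x y * v x)%:E)%E.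
Proof.
transitivity (\sum_(0 <= j < (2 * m).+1)
    ((dcoef m j)%:E * \int[mu]_x (u x * v (x + dnode m j *: y))%:E))%E.
  under eq_bigr do rewrite -(integralZl measurableT (integrable_shift_test _)).
  rewrite -integral_sum//; last first.
    by move=> j; exact: (integrableZl measurableT _ (integrable_shift_test _)).
  apply: eq_integral => x _; rewrite deltaE mulr_sumr -sumEFin.
  by apply: eq_bigr => j _; rewrite -EFinM mulrCA.
transitivity (\sum_(0 <= j < (2 * m).+1)
    ((dcoef m j)%:E * \int[mu]_x (u (x + dnode m j *: y) * v x)%:E))%E; last first.
  under eq_bigr do rewrite -(integralZl measurableT (integrable_test_shift _)).
  rewrite -integral_sum//; last first.
    by move=> j; exact: (integrableZl measurableT _ (integrable_test_shift _)).
  apply: eq_integral => x _; rewrite deltaE mulr_suml -sumEFin.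
  by apply: eq_bigr => j _; rewrite -EFinM mulrA.
rewrite big_nat_rev/= add0n; apply: eq_big_nat => j /andP[_ jm].
rewrite subSS dcoef_rev// dnode_rev// integral_shift_test scaleNr.
by congr (_ * _)%E; apply: eq_integral => x _; rewrite opprK.
Qed.

Lemma integrable_delta_fin k f x (c : R) : measurable_fun setT f ->
  (\int[mu]_y (`|delta k f x y| * K y)%:E <= c%:E)%E ->
  mu.-integrable setT (EFin \o (fun y => delta k f x y * K y)).
Proof.
move=> mf fc; apply/integrableP; split.
  apply/measurable_EFinP; apply: measurable_funM => //; exact: measurable_delta_fixed.
apply: (le_lt_trans _ (ltry c)).
under eq_integral do rewrite /= normrM (ger0_norm (K0 _)).
exact: fc.
Qed.

Variables (D D' : R).
Hypothesis vD : forall x,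
  (\int[mu]_y (`|delta m v x y| * K y)%:E <= (D * w x)%:E)%E.
Hypothesis uD : forall x, v x != 0 ->
  (\int[mu]_y (`|delta m u x y| * K y)%:E <= (D' * (`|u x| + (w x)^-1))%:E)%E.
Hypothesis D0 : 0 <= D.
Hypothesis D'0 : 0 <= D'.

Let F (xy : 'rV[R]_N * 'rV[R]_N) := u xy.1 * (delta m v xy.1 xy.2 * K xy.2).
Let G (xy : 'rV[R]_N * 'rV[R]_N) := (delta m u xy.1 xy.2 * K xy.2) * v xy.1.

Let mF : measurable_fun setT F.
Proof.
apply: measurable_funM; first exact: (measurableT_comp um measurable_fst).
apply: measurable_funM; last exact: (measurableT_comp mK measurable_snd).
exact: measurable_delta.
Qed.

Let mG : measurable_fun setT G.
Proof.
apply: measurable_funM; last exact: (measurableT_comp vm measurable_fst).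
apply: measurable_funM; last exact: (measurableT_comp mK measurable_snd).
exact: measurable_delta.
Qed.

Let mdK f x : measurable_fun setT f ->
  measurable_fun setT (fun y => (`|delta m f x y| * K y)%:E).
Proof.
move=> mf; apply/measurable_EFinP; apply: measurable_funM => //.
by apply: measurableT_comp => //; exact: measurable_delta_fixed.
Qed.

Let iF : (mu \x mu)%E.-integrable setT (EFin \o F).
Proof.
apply/integrable12ltyP; first exact/measurable_EFinP.
apply: (@le_lt_trans _ _ (\int[mu]_x (D%:E * (`|u x| * w x)%:E))%E); last first.
  rewrite ge0_integralZl_EFin//; last 2 first.
  - by move=> x _; rewrite lee_fin.
  - exact/measurable_EFinP.
  by rewrite lte_mul_pinfty ?lee_fin.
apply: ge0_le_integral => //.
- by move=> x _; exact: integral_ge0.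
- apply: (measurable_fun_fubini_tonelli_F (abse \o (EFin \o F))).
    by apply: (measurableT_comp (g := EFin \o F)) => //; exact/measurable_EFinP.
  by move=> z; exact: abse_ge0.
- by apply/measurable_EFinP; apply: measurable_funM.
move=> x _.
under eq_integral => y _ do rewrite /F /= !normrM (ger0_norm (K0 _)) EFinM.
rewrite ge0_integralZl_EFin//; last 2 first.
- by move=> y _; rewrite lee_fin mulr_ge0.
- exact: mdK.
rewrite -EFinM mulrCA EFinM; apply: lee_wpmul2l; first by rewrite lee_fin.
exact: vD.
Qed.

Let G_abs x : (\int[mu]_y `|(G (x, y))%:E| <=
  (D' * C2 * (`|u x| * w x) + D' * C2 * w x)%:E)%E.
Proof.
have R0 : 0 <= D' * C2 * (`|u x| * w x) + D' * C2 * w x.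
  by rewrite addr_ge0// !mulr_ge0// ltW.
have [vx0|vx0] := eqVneq (v x) 0.
  under eq_integral => y _ do rewrite /G /= vx0 mulr0 normr0.
  by rewrite integral0 lee_fin.
under eq_integral => y _ do rewrite /G /= !normrM (ger0_norm (K0 _)) mulrC EFinM.
rewrite ge0_integralZl_EFin//; last 2 first.
- by move=> y _; rewrite lee_fin mulr_ge0.
- exact: mdK.
apply: (@le_trans _ _ (`|v x|%:E * (D' * (`|u x| + (w x)^-1))%:E)%E).
  apply: lee_wpmul2l; first by rewrite lee_fin.
  exact: uD.
rewrite -EFinM lee_fin.
have S0 : 0 <= D' * (`|u x| + (w x)^-1).
  by rewrite mulr_ge0// addr_ge0// invr_ge0 ltW.
rewrite (le_trans (ler_wpM2r S0 (vC x)))//.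
have -> : C2 * (w x * w x) * (D' * (`|u x| + (w x)^-1)) =
  D' * C2 * (`|u x| * w x) * w x + D' * C2 * w x.
  by field; rewrite gt_eqF.
by rewrite lerD2r// ler_piMr// !mulr_ge0// ltW.
Qed.

Let iG : (mu \x mu)%E.-integrable setT (EFin \o G).
Proof.
apply/integrable12ltyP; first exact/measurable_EFinP.
apply: (@le_lt_trans _ _ (\int[mu]_x
    ((D' * C2)%:E * (`|u x| * w x)%:E + (D' * C2)%:E * (w x)%:E))%E); last first.
  have DC : 0 <= D' * C2 by rewrite mulr_ge0.
  rewrite ge0_integralD//; last 4 first.
  - by move=> x _; rewrite -EFinM lee_fin mulr_ge0.
  - by apply/measurable_EFinP; apply: measurable_funM.
  - by move=> x _; rewrite -EFinM lee_fin mulr_ge0// ltW.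
  - by apply/measurable_EFinP; apply: measurable_funM.
  rewrite ge0_integralZl_EFin//; last 2 first.
  - by move=> x _; rewrite lee_fin.
  - exact/measurable_EFinP.
  rewrite ge0_integralZl_EFin//; last 2 first.
  - by move=> x _; rewrite lee_fin ltW.
  - exact/measurable_EFinP.
  by rewrite lte_add_pinfty// lte_mul_pinfty ?lee_fin.
apply: ge0_le_integral => //.
- by move=> x _; exact: integral_ge0.
- apply: (measurable_fun_fubini_tonelli_F (abse \o (EFin \o G))).
    by apply: (measurableT_comp (g := EFin \o G)) => //; exact/measurable_EFinP.
  by move=> z; exact: abse_ge0.
- by apply: emeasurable_funD; apply/measurable_EFinP; apply: measurable_funM.
by move=> x _; exact: G_abs.
Qed.

Let FE x : fubini_F mu (EFin \o F) x =
  (u x * \int[mu]_y (delta m v x y * K y))%:E.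
Proof.
have idv := integrable_delta_fin vm (vD x).
rewrite /fubini_F /F /=; under eq_integral do rewrite EFinM.
rewrite (integralZl measurableT idv) EFinM; congr (_ * _)%E.
by rewrite fineK//; exact: integrable_fin_num idv.
Qed.

Let GE x : fubini_F mu (EFin \o G) x =
  ((\int[mu]_y (delta m u x y * K y)) * v x)%:E.
Proof.
have [vx0|vx0] := eqVneq (v x) 0.
  rewrite /fubini_F /G /= vx0 mulr0; under eq_integral do rewrite mulr0.
  by rewrite integral0.
have idu := integrable_delta_fin um (uD vx0).
rewrite /fubini_F /G /=; under eq_integral do rewrite EFinM.
rewrite (integralZr measurableT idu) EFinM; congr (_ * _)%E.
by rewrite fineK//; exact: integrable_fin_num idu.
Qed.

(** Both sides are iterated integrals of [F] and [G], in the order [y] then [x].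
In the opposite order their inner integrals agree for every [y]. *)
Lemma nonlocal_fubini :
  [/\ mu.-integrable setT (EFin \o (fun x => u x * \int[mu]_y (delta m v x y * K y))),
      mu.-integrable setT (EFin \o (fun x => (\int[mu]_y (delta m u x y * K y)) * v x)) &
      (\int[mu]_x (u x * \int[mu]_y (delta m v x y * K y))%R%:E =
       \int[mu]_x ((\int[mu]_y (delta m u x y * K y)) * v x)%R%:E)%E].
Proof.
split.
- by have := integrable_fubini_F iF; apply: eq_integrable => // x _; exact: FE.
- by have := integrable_fubini_F iG; apply: eq_integrable => // x _; exact: GE.
transitivity (\int[mu]_x fubini_F mu (EFin \o F) x)%E.
  by apply: eq_integral => x _; rewrite FE.
transitivity (\int[mu]_x fubini_F mu (EFin \o G) x)%E; last first.
  by apply: eq_integral => x _; rewrite GE.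
rewrite (Fubini iF) (Fubini iG); apply: eq_integral => y _ /=.
transitivity ((K y)%:E * \int[mu]_x (u x * delta m v x y)%:E)%E.
  rewrite -(integralZl measurableT (integrable_mul_delta y)).
  by apply: eq_integral => x _; rewrite /F /= -EFinM; congr EFin; ring.
rewrite integral_delta_sym -(integralZl measurableT (integrable_delta_mul y)).
by apply: eq_integral => x _; rewrite /G /= -EFinM; congr EFin; ring.
Qed.

End nonlocal_fubini.

(** * Functions that are Borel up to a negligible set *)

Section ae_integral.
Local Open Scope ereal_scope.
Context d (T : measurableType d) (R : realType) (mu : {measure set T -> \bar R}).

Lemma ge0_le_integral_nonmeasurable (f g : T -> \bar R) :
  (forall x, 0 <= f x) -> (forall x, f x <= g x) ->
  \int[mu]_x f x <= \int[mu]_x g x.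
Proof.
move=> f0 fg; have g0 x : 0 <= g x by exact: le_trans (fg x).
rewrite !ge0_integralTE//; apply: le_ereal_sup => _ [h hf <-].
by exists h => // x; exact: le_trans (fg x).
Qed.

(** Outside of a measurable null set [A] the functions agree; [f] lies between the
measurable functions equal to [g] outside of [A] and to [0], respectively
[+oo], on [A], and the integral of nonnegative functions is a supremum that is
monotone without measurability. *)
Lemma ge0_integral_ae_eq_measurable (f g : T -> \bar R) :
  measurable_fun setT g -> (forall x, 0 <= f x) -> (forall x, 0 <= g x) ->
  {ae mu, forall x, f x = g x} -> \int[mu]_x f x = \int[mu]_x g x.
Proof.
move=> mg f0 g0 [A [mA A0 fgA]].
have fg x : ~ A x -> f x = g x by move=> Ax; apply: contrapT => /fgA.
pose lo x := if x \in A then 0 else g x.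
pose hi x := if x \in A then +oo else g x.
have mIA : measurable_fun setT (fun x => x \in A).
  apply: (measurable_fun_bool true); rewrite setTI.
  have -> : (fun x => x \in A) @^-1` [set true] = A.
    by apply/seteqP; split => x /=; [exact: set_mem|exact: mem_set].
  by [].
have mlo : measurable_fun setT lo by apply: measurable_fun_ifT.
have mhi : measurable_fun setT hi by apply: measurable_fun_ifT.
have aelo : ae_eq mu setT lo g.
  exists A; split => // x /=; apply: contra_notP => Ax _.
  by rewrite /lo memNset.
have aehi : ae_eq mu setT hi g.
  exists A; split => // x /=; apply: contra_notP => Ax _.
  by rewrite /hi memNset.
have lo0 x : 0 <= lo x by rewrite /lo; case: ifP.
have hi0 x : 0 <= hi x by rewrite /hi; case: ifP.
apply/eqP; rewrite eq_le; apply/andP; split.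
  rewrite -(ge0_ae_eq_integral _ mhi mg)//.
  apply: ge0_le_integral_nonmeasurable => // x; rewrite /hi; case: ifPn => [_|].
    exact: leey.
  by rewrite notin_setE => /fg ->.
rewrite -(ge0_ae_eq_integral _ mlo mg)//.
apply: ge0_le_integral_nonmeasurable => // x; rewrite /lo; case: ifPn => [_//|].
by rewrite notin_setE => /fg ->.
Qed.

Lemma integral_ae_eq_measurable (f g : T -> \bar R) :
  measurable_fun setT g ->
  {ae mu, forall x, f x = g x} -> \int[mu]_x f x = \int[mu]_x g x.
Proof.
move=> mg fg; rewrite integralE [RHS]integralE; congr (_ - _).
- apply: ge0_integral_ae_eq_measurable => //; first exact: measurable_funepos.
  by apply: filterS fg => x; rewrite !funeposE => ->.
- apply: ge0_integral_ae_eq_measurable => //; first exact: measurable_funeneg.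
  by apply: filterS fg => x; rewrite !funenegE => ->.
Qed.

End ae_integral.

Section borel_representative.
Context {R : realType} {n : nat}.
Implicit Types (x y z : 'rV[R]_n) (f u v : 'rV[R]_n -> R) (U : set 'rV[R]_n).
Local Notation mu := (lebesgue_rV R n).

Lemma open_continuous_measurable_rV U f : open U ->
  (forall x, U x -> {for x, continuous f}) -> measurable_fun U f.
Proof.
move=> oU cf; apply: (measurability (@RGenOInfty.G R)).
  exact: RGenOInfty.measurableE.
move=> _ [_ [r ->] <-]; apply: open_measurable_rV.
rewrite openE => x [Ux fx]; apply: filterI; first exact: open_nbhs_nbhs.
apply: (cf x Ux); apply: open_nbhs_nbhs; split => //; exact: interval_open.
Qed.

Lemma compact_ball_rV (r : R) : compact [set x : 'rV[R]_n | `|x| <= r].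
Proof.
apply: bounded_closed_compact.
  by exists r; split; [exact: num_real|move=> t rt x /= xr; exact: le_trans (ltW rt)].
have -> : [set x : 'rV[R]_n | `|x| <= r] = Num.norm @^-1` [set t : R | t <= r] by [].
by apply: closed_comp; [move=> x _; exact: norm_continuous|exact: closed_le].
Qed.

(** Local integrability provides a Borel function on each closed ball centered at
[0].  They are glued along the shells [k <= |x| < k + 1], outside of [U]. *)
Lemma borel_representative U u : open U ->
  (forall x, U x -> {for x, continuous u}) -> L1loc u ->
  exists u0 : 'rV[R]_n -> R, [/\ measurable_fun setT u0,
    forall x, U x -> u0 x = u x & {ae mu, forall x, u x = u0 x}].
Proof.
move=> oU cu lu.
have mU := open_measurable_rV oU.
pose B k : set 'rV[R]_n := [set x | `|x| <= k%:R].
have /choice[g gP] : forall k, exists g : 'rV[R]_n -> R,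
    measurable_fun (B k) g /\ {ae mu, forall x, B k x -> u x = g x}.
  move=> k; have [g ig ug] := lu (B k) (@compact_ball_rV k%:R).
  exists g; split => //; apply/measurable_EFinP; exact: measurable_int ig.
pose u0 x := if x \in U then u x else g (Num.truncn `|x|).+1 x.
exists u0; split.
- pose S k : set 'rV[R]_n := [set x | k%:R <= `|x| < k.+1%:R].
  have mS k : measurable (S k).
    have -> : S k = setT `&` (fun x : 'rV[R]_n => `|x|) @^-1` `[k%:R, k.+1%:R[%classic.
      by rewrite setTI; apply/seteqP; split => x /=; rewrite in_itv.
    exact: measurable_normr_rV.
  have -> : [set: 'rV[R]_n] = U `|` \bigcup_k (S k `\` U).
    apply/esym; rewrite -subTset => x _; have [Ux|Ux] := pselect (U x); [by left|right].
    by exists (Num.truncn `|x|) => //; split => //=; exact: truncn_itv.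
  have mSU k : measurable (S k `\` U) by exact: measurableD.
  apply/measurable_funU => //; first exact: bigcup_measurable.
  split.
    apply: (eq_measurable_fun u); first by move=> x xU; rewrite /u0 xU.
    exact: open_continuous_measurable_rV.
  apply/measurable_fun_bigcup => // k.
  apply: (eq_measurable_fun (g k.+1)).
    move=> x /set_mem[/= Sx Ux]; rewrite /u0 memNset//.
    by rewrite (truncn_def Sx).
  apply: measurable_funS (gP k.+1).1; first exact: measurable_ball_rV.
  by move=> x [/= /andP[_ /ltW]].
- by move=> x Ux; rewrite /u0 mem_set.
- have : {ae mu, forall x, forall k, B k x -> u x = g k x}.
    by apply: ae_foralln => k; exact: (gP k).2.
  apply: filterS => x H; rewrite /u0; case: ifPn => // _.
  by apply: H; rewrite /B /=; exact/ltW/truncnS_gt.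
Qed.

Lemma ae_affine (P : 'rV[R]_n -> Prop) x (k : R) : k != 0 ->
  {ae mu, forall z, P z} -> {ae mu, forall y, P (x + k *: y)}.
Proof.
move=> k0 [A [mA A0 PA]].
exists ((fun y => x + k *: y) @^-1` A); split; last by move=> y /= /PA.
  by have := @measurable_affine_rV _ _ x k measurableT _ mA; rewrite setTI.
have mAx : measurable ((fun y : 'rV[R]_n => x + k *: y) @^-1` A).
  by have := @measurable_affine_rV _ _ x k measurableT _ mA; rewrite setTI.
have E : (\int[mu]_y (\1_A (x + k *: y)%R)%:E)%E = mu ((fun y => x + k *: y) @^-1` A).
  by have := integral_indic mu measurableT mAx; rewrite setIT => <-.
rewrite -E (@ge0_integral_affine _ _ (fun z => (\1_A z)%:E))//.
- have -> : (\int[mu]_y (\1_A y)%:E)%E = 0%E; last by rewrite mule0.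
  by have := integral_indic mu measurableT mA; rewrite setIT => ->; exact: A0.
- exact/measurable_EFinP/measurable_indic.
Qed.

(** An affine map with nonzero ratio pulls negligible sets back to negligible
sets.  The central node does not depend on [y], whence the hypothesis at [x]. *)
Lemma delta_ae_eq m (u u0 : 'rV[R]_n -> R) x : u x = u0 x ->
  {ae mu, forall z, u z = u0 z} ->
  {ae mu, forall y, delta m u x y = delta m u0 x y}.
Proof.
move=> ux uu.
have : {ae mu, forall y, forall j, u (x + dnode m j *: y) = u0 (x + dnode m j *: y)}.
  apply: ae_foralln => j; have [->|k0] := eqVneq (dnode m j : R) 0.
    by apply: aeW => y; rewrite scale0r addr0.
  exact: (@ae_affine (fun z => u z = u0 z)).
by apply: filterS => y H; rewrite !deltaE; apply: eq_bigr => j _; rewrite H.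
Qed.

End borel_representative.

(** * Test functions and the duality *)

Section test_functions.
Context {R : realType} {N : nat}.
Implicit Types (x y z : 'rV[R]_N) (f u v : 'rV[R]_N -> R) (U : set 'rV[R]_N).
Local Notation mu := (lebesgue_rV R N).
Variable N_gt0 : (0 < N)%N.

Lemma weight_ge_ball (p r : R) (z : 'rV[R]_N) : 0 <= p -> `|z| <= r ->
  (1 + (N%:R * r) `^ p)^-1 <= weight p z.
Proof.
move=> p0 zr; rewrite lef_pV2 ?posrE ?ltr_pwDl ?powR_ge0//.
have r0 := le_trans (normr_ge0 z) zr.
rewrite lerD2l ge0_ler_powR ?nnegrE ?enorm_ge0 ?mulr_ge0//.
by rewrite (le_trans (enorm_le_normr _ N_gt0))// ler_wpM2l.
Qed.

Lemma delta_locally_le_eq m u u0 U a x0 : open U -> U x0 ->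
  (forall x, U x -> u0 x = u x) -> delta_locally_le m u a x0 ->
  delta_locally_le m u0 a x0.
Proof.
move=> oU Ux0 uu [e [C [e0 C0 H]]].
have /nbhs_ballP[r /= r0 xU] := open_nbhs_nbhs (conj oU Ux0).
pose e' := Num.min e (r / m.+1%:R).
exists e', C; split => //; first by rewrite lt_min e0 divr_gt0.
move=> x y; rewrite !lt_min => /andP[xe xr] /andP[ye yr].
suff -> : delta m u0 x y = delta m u x y by exact: H.
rewrite !deltaE; apply: eq_big_nat => j /andP[_ jm]; congr (_ * _); apply: uu.
apply: xU; rewrite -ball_normE /=.
have -> : x0 - (x + dnode m j *: y) = - ((x - x0) + dnode m j *: y).
  by rewrite !opprD opprK addrA [x0 - x]addrC.
rewrite normrN (le_lt_trans (ler_normD _ _))// normrZ.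
apply: (@lt_le_trans _ _ (r / m.+1%:R + m%:R * (r / m.+1%:R))).
  by rewrite ltr_leD// ler_pM ?dnode_le// ltW.
by rewrite -[X in X + _]mul1r -mulrDl nat1r mulrC divfK.
Qed.

(** The exponent is [k + tau = b + beta] if [k < 2 * m].  Otherwise differences of
order [2 * m] cannot see the additional smoothness, and the exponent is
[2 * m], which is still greater than [b]. *)
Lemma C_space_delta_locally_le m (b beta : R) U u : (0 < m)%N -> 0 < b ->
  b < (2 * m)%:R -> 0 < beta -> open U -> C_space (b + beta) U u ->
  exists2 a, b < a & forall x0, U x0 -> delta_locally_le m u a x0.
Proof.
move=> m0 b0 b2m beta0 oU [k [tau [/andP[tau0 tau1] bE ku hu]]].
have [km|mk] := ltnP k (2 * m).
  exists (k%:R + tau); first by rewrite -bE ltrDl.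
  by move=> x0 Ux0; exact: (delta_locally_le_holder N_gt0 km tau0 oU).
exists (2 * m)%:R => // x0 Ux0; apply: (@delta_locally_le_smooth _ _ _ U) => //.
have [k1 k2] := ku; split.
  by move=> l i x lm; apply: k1; exact: leq_trans mk.
by move=> l x lm; apply: k2; exact: leq_trans mk.
Qed.

Lemma C_c_infty_continuous U v x : C_c_infty U v -> {for x, continuous v}.
Proof. by move=> [/(_ 0%N)[_ /(_ [::] x)] + _ _]; apply. Qed.

(** On a ball the weight is bounded below, hence can be inserted in the bounds of
[v] and of its difference.  Outside of the ball of radius [r + m], where [r]
bounds the support, the difference vanishes for [|y| < 1]. *)
Lemma C_c_infty_bounds m U v (b : R) : (0 < m)%N -> 0 < b -> C_c_infty U v ->
  [/\ measurable_fun setT v,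
      exists C2 : R, forall z, `|v z| <= C2 * (weight (N%:R + b) z * weight (N%:R + b) z) &
      exists e C : R, [/\ 0 < e, 0 <= C & forall x y, `|y| < e ->
        `|delta m v x y| <= C * weight (N%:R + b) x * `|y| `^ (2 * m)%:R]].
Proof.
move=> m0 b0 vC; have cv x := C_c_infty_continuous (x := x) vC.
have p0 : 0 <= N%:R + b by rewrite addr_ge0// ltW.
set p := N%:R + b in p0 *.
have [kv cK _] := vC; set K := closure _ in cK.
have vK x : v x != 0 -> K x by move=> vx; exact: subset_closure.
have [r Kr] : exists r, forall x, K x -> `|x| <= r.
  have [M [_ KM]] := compact_bounded cK.
  by exists (M + 1) => x Kx; apply: (KM (M + 1)) => //; rewrite ltrDl.
(* the support may be empty, and [r] negative *)
wlog r0 : r Kr / 0 <= r.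
  move=> H; apply: (H (Num.max r 0)); last by rewrite le_max lexx orbT.
  by move=> x /Kr xr; rewrite le_max xr.
have vr x : r < `|x| -> v x = 0.
  move=> rx; apply/eqP; apply: contraTT rx => /vK /Kr.
  by rewrite leNgt.
pose c (t : R) := (1 + (N%:R * t) `^ p)^-1.
have c0 t : 0 < c t by rewrite invr_gt0 ltr_pwDl ?powR_ge0.
split.
- exact: open_continuous_measurable_rV openT _.
- have [M vM] : exists M : R, forall x, `|v x| <= M.
    have /compact_bounded[M [_ KM]] : compact (v @` K).
      by apply: continuous_compact => //; apply: continuous_subspaceT => x; exact: cv.
    exists (Num.max (M + 1) 0) => x; have [->|vx] := eqVneq (v x) 0.
      by rewrite normr0 le_max lexx orbT.
    rewrite le_max; apply/orP; left; apply: (KM (M + 1)); first by rewrite ltrDl.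
    by exists x => //; exact: vK.
  have M0 : 0 <= M by rewrite (le_trans _ (vM 0)).
  have cc : 0 < c r * c r by rewrite mulr_gt0.
  exists (M / (c r * c r)) => z.
  have wz := ltW (weight_gt0 p z).
  have [rz|zr] := ltP r `|z|.
    by rewrite vr// normr0 mulr_ge0//; [rewrite divr_ge0// ltW|rewrite mulr_ge0].
  rewrite (le_trans (vM z))// mulrAC ler_pdivlMr// ler_wpM2l//.
  by rewrite ler_pM ?(ltW (c0 _)) ?weight_ge_ball.
(* for [|y| < 1] the nodes of the difference are at distance at most [m] from [x] *)
have cB := @compact_ball_rV R N (r + m%:R).
have [|e [C [e0 C0 H]]] := @delta_compact_le R N m v (2 * m)%:R _ cB.
  by move=> x0 _; exact: (delta_locally_le_smooth m0 openT).
exists (Num.min e 1), (C / c (r + m%:R)); split.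
- by rewrite lt_min e0 ltr01.
- by rewrite divr_ge0// ltW.
move=> x y; rewrite lt_min => /andP[ye y1].
have [xr|rx] := leP `|x| (r + m%:R).
  rewrite (le_trans (H x y xr ye))// ler_wpM2r ?powR_ge0// mulrAC ler_pdivlMr//.
  by rewrite ler_wpM2l// weight_ge_ball.
rewrite deltaE big_nat_cond big1 ?normr0.
  have wx := ltW (weight_gt0 p x); have cx := ltW (c0 (r + m%:R)).
  by rewrite mulr_ge0 ?powR_ge0// mulr_ge0// divr_ge0.
move=> j; rewrite andbT => /andP[_ jm]; rewrite vr ?mulr0//.
rewrite -(ltrD2r m%:R) (lt_le_trans rx)//.
have {1}-> : x = (x + dnode m j *: y) - dnode m j *: y by rewrite addrK.
rewrite (le_trans (ler_normB _ _))// lerD2l normrZ.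
rewrite (le_trans (ler_wpM2r (normr_ge0 _) (dnode_le jm)))//.
by rewrite ler_piMr// ltW.
Qed.

(** The integral of [f] is that of its Borel representative, although [f] itself
need not be Borel. *)
Lemma lebesgue_integrable_ae (f g : 'rV[R]_N -> R) :
  mu.-integrable setT (EFin \o g) -> {ae mu, forall x, f x = g x} ->
  lebesgue_integrable setT f /\ \int[mu]_x f x = \int[mu]_x g x.
Proof.
move=> ig fg; split; first by exists g => //; apply: filterS fg => x ->.
rewrite /Rintegral; congr fine.
apply: integral_ae_eq_measurable; first exact: measurable_int ig.
by apply: filterS fg => x ->.
Qed.

Lemma weighted_integral_lty (p : R) u u0 : measurable_fun setT u0 ->
  {ae mu, forall x, u x = u0 x} ->
  lebesgue_integrable setT (fun x => `|u x| / (1 + enorm x `^ p)) ->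
  (\int[mu]_x (`|u0 x| * weight p x)%:E < +oo)%E.
Proof.
move=> u0m uu0 [g /integrableP[mg ig] ug].
rewrite (@ge0_integral_ae_eq_measurable _ _ _ mu _ (fun x => `|(g x)%:E|%E))//.
- by apply: measurableT_comp.
- by move=> x; rewrite lee_fin mulr_ge0// ltW// weight_gt0.
apply: filterS2 uu0 ug => x <- /(_ I) <-.
congr EFin; rewrite [RHS]ger0_norm//; apply: mulr_ge0 => //.
exact/ltW/(weight_gt0 p x).
Qed.

End test_functions.

Theorem lemma1p5 (R : realType) (N m : nat) (beta s : R) (U : set 'rV[R]_N)
    (u : 'rV[R]_N -> R) (N_gt0 : (0 < N)%N) (m_gt0 : (0 < m)%N)
    (beta01 : 0 < beta < 1) (s0m : 0 < s < m%:R) (openU : open U)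
    (uC : C_space (2 * s + beta) U u) (uL1 : calL1 s u)
    (phi : 'rV[R]_N -> R) (phiC : C_c_infty U phi) :
  [/\ forall x, lebesgue_integrable setT (L_integrand m s phi x),
      forall x, U x -> lebesgue_integrable setT (L_integrand m s u x),
      lebesgue_integrable setT (fun x => u x * L_op m s phi x),
      lebesgue_integrable setT (fun x => L_op m s u x * phi x) &
      \int[lebesgue_rV R N]_x (u x * L_op m s phi x) =
      \int[lebesgue_rV R N]_x (L_op m s u x * phi x)].
Proof.
move: s0m beta01 => /andP[s0 sm] /andP[beta0 _].
pose b := 2 * s; have b0 : 0 < b by rewrite mulr_gt0.
have b2m : b < (2 * m)%:R by rewrite natrM ltr_pM2l.
pose p := N%:R + b.
have [a ba ua] := C_space_delta_locally_le N_gt0 m_gt0 b0 b2m beta0 openU uC.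
have cu x : U x -> {for x, continuous u}.
  by move=> Ux; have [k [tau [_ _ [_ /(_ [::] x) +] _]]] := uC; apply.
(* the differences of [u0] and of [u] at [x] in [U] agree for almost every [y],
   the value at the central node being the same *)
have [u0 [u0m u0U uu0]] := borel_representative openU cu uL1.1.
have u0I := weighted_integral_lty u0m uu0 uL1.2.
have [mphi [C2 phiC2] [e [C [e0 C0 phinear]]]] := C_c_infty_bounds N_gt0 m_gt0 b0 phiC.
have [_ cK KU] := phiC; set K := closure _ in cK KU.
have phiK x : phi x != 0 -> K x by move=> ?; exact: subset_closure.
have w0 (x : 'rV[R]_N) : 0 < weight p x by exact: weight_gt0.
have [D D0 phiD] := @delta_kern_le _ _ m b b0 phi (weight p) setT _ e C mphi
  (fun x => ltW (w0 x)) (fun k => shift_bounded_test N_gt0 b0 mphi phiC2) b2m e0 C0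
  (fun x y _ => phinear x y).
(* [B >= 1], so the bound near the diagonal can be given the factor [B] as well *)
pose B x := `|u0 x| + (weight p x)^-1.
have B1 x : 1 <= B x.
  by rewrite /B ler_wpDl// invf_ge1// weight_le1.
have u0D (A : set 'rV[R]_N) : compact A -> A `<=` U -> exists2 D' : R, 0 <= D' &
    forall x, A x -> (\int[lebesgue_rV R N]_y (`|delta m u0 x y| * kern p y)%:E <= (D' * B x)%:E)%E.
  move=> cA AU.
  have [|e' [C' [e'0 C'0 H]]] := @delta_compact_le _ _ m u0 a A cA.
    by move=> x0 /AU Ux0; exact: (delta_locally_le_eq openU Ux0 u0U (ua _ Ux0)).
  apply: (@delta_kern_le _ _ m b b0 u0 B A a e' C') => //.
  - by move=> x; exact: le_trans (B1 x).
  - by move=> k; exact: shift_bounded_weighted.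
  move=> x y Ax ye; rewrite (le_trans (H x y Ax ye))// ler_wpM2r ?powR_ge0//.
  by rewrite ler_peMr.
have [D' D'0 uD'] := u0D K cK KU.
have uD x : phi x != 0 -> _ := fun h => uD' x (phiK x h).
have [i1 i2 FI] := nonlocal_fubini N_gt0 b0 u0m mphi u0I phiC2
  (fun x => phiD x I) uD D0 D'0.
have dphi x := integrable_delta_fin mphi (phiD x I).
have du x : U x -> (lebesgue_rV R N).-integrable setT
    (EFin \o (fun y => delta m u0 x y * kern p y)).
  move=> Ux; have xU : [set x] `<=` U by move=> _ ->.
  have [Dx _ H] := u0D [set x] (@compact_set1 _ x) xU.
  exact: (integrable_delta_fin u0m (H x erefl)).
have Lu x : U x ->
  lebesgue_integrable setT (L_integrand m s u x) /\
  \int[lebesgue_rV R N]_y L_integrand m s u x y =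
  \int[lebesgue_rV R N]_y (delta m u0 x y * kern p y).
  move=> Ux; apply: lebesgue_integrable_ae; first exact: du.
  have := delta_ae_eq m (esym (u0U x Ux)) uu0; apply: filterS => y Hy.
  by rewrite /L_integrand Hy.
pose c := c_const N m s / 2.
have phiU x : phi x != 0 -> U x by move=> /phiK /KU.
have Lphi x : L_op m s phi x = c * \int[lebesgue_rV R N]_y (delta m phi x y * kern p y) by [].
have [I3 E3] : lebesgue_integrable setT (fun x => u x * L_op m s phi x) /\
  \int[lebesgue_rV R N]_x (u x * L_op m s phi x) = \int[lebesgue_rV R N]_x (c *
    (u0 x * \int[lebesgue_rV R N]_y (delta m phi x y * kern p y))).
  apply: lebesgue_integrable_ae.
    by have := integrableZl measurableT c i1; apply: eq_integrable.
  by apply: filterS uu0 => x ->; rewrite Lphi mulrCA.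
have [I4 E4] : lebesgue_integrable setT (fun x => L_op m s u x * phi x) /\
  \int[lebesgue_rV R N]_x (L_op m s u x * phi x) = \int[lebesgue_rV R N]_x (c *
    ((\int[lebesgue_rV R N]_y (delta m u0 x y * kern p y)) * phi x)).
  apply: lebesgue_integrable_ae.
    by have := integrableZl measurableT c i2; apply: eq_integrable.
  apply: aeW => x; have [->|/phiU /Lu[_ E]] := eqVneq (phi x) 0.
    by rewrite !mulr0.
  by rewrite /L_op E mulrA.
split => //.
- by move=> x; apply: (lebesgue_integrable_ae (dphi x) _).1; exact: aeW.
- by move=> x /Lu[].
rewrite E3 E4 (RintegralZl _ measurableT i1) (RintegralZl _ measurableT i2).
by congr (_ * _); rewrite /Rintegral FI.
Qed.
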